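(* Let $H\in\{\mathbb{Z}_{2(n+1)},D_{2n},A_4,S_4,A_5\}$ with $n\geq 1$, and let $k\geq 2$. Then the right group $\mathbb{Z}_2\times H\times R_k$ is not planar.
   Context: $\mathbb{Z}_m$ is the cyclic group of order $m$, $D_m$ the dihedral group of order $2m$, $A_n,S_n$ the alternating and symmetric groups, $R_k=\{r_1,\dots,r_k\}$ the right zero band ($r_ir_j=r_j$), products are direct products. A semigroup $S$ is planar if there is a generating set $C$ of $S$ such that the Cayley graph (vertex set $S$, arcs $(s,sc)$, $s\in S$, $c\in C$), with directions, loops and multiple edges ignored, is planar. *)

(* Defs.v *)
From HB Require Import structures.
From mathcomp Require Import all_boot all_order all_algebra all_fingroup all_solvable.
From mathcomp Require Import all_classical all_reals all_analysis.

Set Implicit Arguments.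
Unset Strict Implicit.
Unset Printing Implicit Defensive.

Import numFieldNormedType.Exports.
Local Open Scope classical_set_scope.

(* A graph on a vertex type V is given by a symmetric irreflexive adjacency
   relation, and the edge joining x and y is identified with [set x; y]. *)

Definition is_arc (R : realType) (A : set (R * R)) (p q : R * R) : Prop :=
  exists f : R -> R * R,
    [/\ {within `[0%R, 1%R], continuous f},
        {in `[0%R, 1%R]%classic &, injective f},
        f 0%R = p, f 1%R = q & A = f @` `[0%R, 1%R]].

(* E x y is the arc representing the edge [set x; y]; its values on
   non-adjacent pairs are irrelevant. *)
Definition is_plane_drawing (R : realType) (V : Type) (adj : V -> V -> Prop)
    (pos : V -> R * R) (E : V -> V -> set (R * R)) : Prop :=
  [/\ injective pos,
      forall x y, adj x y -> E x y = E y x /\ is_arc (E x y) (pos x) (pos y),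
      forall x y z, adj x y -> E x y (pos z) -> z = x \/ z = y
    & forall x y x' y', adj x y -> adj x' y' ->
        [set x; y] <> [set x'; y'] ->
        E x y `&` E x' y' `<=` pos @` ([set x; y] `&` [set x'; y'])].

Definition planar_graph (R : realType) (V : Type) (adj : V -> V -> Prop) :
    Prop :=
  exists (pos : V -> R * R) (E : V -> V -> set (R * R)),
    is_plane_drawing adj pos E.

(* Every element of S is a product of one or more elements of C. *)
Definition generates (S : semigroupType) (C : set S) : Prop :=
  smallest [set A : set S | forall x y, A x -> A y -> A (x * y)%g] C = [set: S].

Definition cayley_arc (S : semigroupType) (C : set S) (s t : S) : Prop :=
  exists2 c, C c & t = (s * c)%g.

Definition cayley_adj (S : semigroupType) (C : set S) (s t : S) : Prop :=
  s <> t /\ (cayley_arc C s t \/ cayley_arc C t s).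

Definition planar_semigroup (R : realType) (S : semigroupType) : Prop :=
  exists C : set S, generates C /\ planar_graph R (cayley_adj C).

Definition right_zero_band (k : nat) : Type := 'I_k.

Section RightZeroBand.
Variable k : nat.

HB.instance Definition _ := Choice.on (right_zero_band k).

Definition right_zero_mul (i j : right_zero_band k) : right_zero_band k := j.

Lemma right_zero_mulA : associative right_zero_mul.
Proof. by []. Qed.

HB.instance Definition _ :=
  isSemigroup.Build (right_zero_band k) right_zero_mulA.

End RightZeroBand.

(* The dihedral group of order 2 * m, for m >= 2. *)
Definition dihedral_group (m : nat) : finGroupType :=
  dihedral_gtype (2 * m).

(* Main.v *)
(** A plane drawing gives mod-2 data: for an edge [uu'] and a vertex [v] off it,
    the parity [n u u' v] of the crossings of the edge with the downward ray from
    [v], and for two vertices their lexicographic order [s u v].  For two disjoint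
    edges these satisfy one linear relation over F_2, because the difference of the
    two arcs has winding number 0 around the boundary of the parameter square.
    Data of this kind pass to minors, and adding up the relations over all pairs of
    disjoint edges excludes K_5 and K_{3,3}; by Mader's contraction argument no
    graph with N >= 3 vertices and at least 3N - 5 edges carries such data.

    Let G = Z_2 x H and let (a, i) be a generator.  Contracting the edges from
    (g, j), j <> i, to (ga, i) turns the graph of G x R_k into a Cayley graph of G
    in which every other generator x contributes, up to conjugation by a, both x
    and ax (or a^-1 x).  If G needs three generators this graph is too dense.
    Otherwise G = <a, b> and the graph contains that of {a, b, ab}.  For H dihedral
    G is not 2-generated; for H cyclic either the graph is 6-regular or there is a
    K_5 minor.  For A_4, S_4, A_5 one of a, b, ab is v = (1, v') with v' of odd
    order p >= 3, so v^p is central: the cycle of the powers of v and three chords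
    running through the cosets v^i u <v>, i = 0, 1, 2, form a K_{3,3} minor. *)

From Stdlib Require Import Btauto.
Require Import Defs.
From mathcomp Require Import all_boot all_order all_algebra all_fingroup all_solvable.
From mathcomp Require Import all_classical all_reals all_analysis.
From mathcomp Require Import fintype finset lra zify.

Set Implicit Arguments.
Unset Strict Implicit.
Unset Printing Implicit Defensive.

(** * Mod-2 drawings *)

(** For lexicographic [s] and ray-crossing [n]: as (p, q) runs round a square, [q - p] crosses the
    upper vertical half-axis an even number of times. On the sides where [q] moves, [n] sees the
    lower half-axis instead; the order changes on the right convert one count into the other. *)
Definition parity_cell (P : Type) (s : P -> P -> bool) (n : P -> P -> P -> bool)
    (p p' q q' : P) : bool :=
  n p p' q (+) n p p' q' (+) (n q q' p (+) n q q' p') ==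
  s p q (+) s p q' (+) (s p' q (+) s p' q').

Definition walk_crossing (P : Type) (n : P -> P -> P -> bool)
    (p : nat -> P) (N : nat) (r : P) : bool :=
  \big[addb/false]_(i < N) n (p i) (p i.+1) r.

Lemma walk_crossingS (P : Type) (n : P -> P -> P -> bool) p N r :
  walk_crossing n p N.+1 r = walk_crossing n p N r (+) n (p N) (p N.+1) r.
Proof. by rewrite /walk_crossing big_ord_recr. Qed.

Lemma walk_crossing0 (P : Type) (n : P -> P -> P -> bool) p r :
  walk_crossing n p 0 r = false.
Proof. by rewrite /walk_crossing big_ord0. Qed.

Lemma addbE (a b : bool) : a (+) b = xorb a b.
Proof. by case: a b => [] []. Qed.

Lemma addb_sum_eq (a b c d x y : bool) :
  a = b -> c = d -> a (+) c (+) x = b (+) d (+) y -> x = y.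
Proof. by move=> -> ->; apply: addbI. Qed.

(** Terms at the inner points of a strip of cells occur twice and cancel. [parity_walk] adds up such
    strips in the other direction. *)
Lemma parity_step_walk (P : Type) (s : P -> P -> bool) n (x y : P) q M :
    (forall j, j < M -> parity_cell s n x y (q j) (q j.+1)) ->
  n x y (q 0) (+) n x y (q M) (+)
    (walk_crossing n q M x (+) walk_crossing n q M y) =
  s x (q 0) (+) s x (q M) (+) (s y (q 0) (+) s y (q M)).
Proof.
elim: M => [|M IH] cells; first by rewrite !walk_crossing0 !addbb.
rewrite !walk_crossingS.
apply: (addb_sum_eq (IH (fun j jM => cells j (ltnW jM)))
                    (eqP (cells M (ltnSn M)))).
by rewrite !addbE; btauto.
Qed.

Lemma parity_walk (P : Type) (s : P -> P -> bool) n (p q : nat -> P) N M :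
    (forall i j, i < N -> j < M ->
       parity_cell s n (p i) (p i.+1) (q j) (q j.+1)) ->
  walk_crossing n p N (q 0) (+) walk_crossing n p N (q M) (+)
    (walk_crossing n q M (p 0) (+) walk_crossing n q M (p N)) =
  s (p 0) (q 0) (+) s (p 0) (q M) (+) (s (p N) (q 0) (+) s (p N) (q M)).
Proof.
elim: N => [|N IH] cells; first by rewrite !walk_crossing0 !addbb.
rewrite !walk_crossingS.
apply: (addb_sum_eq (IH (fun i j iN => cells i j (ltnW iN)))
                    (parity_step_walk (fun j => cells N j (ltnSn N)))).
by rewrite !addbE; btauto.
Qed.

(* A mod-2 van Kampen certificate; [n u u' v] need not be symmetric in [u], [u']. *)
Definition parity_planar (V : eqType) (e : rel V) : Prop :=
  exists (s : V -> V -> bool) (n : V -> V -> V -> bool),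
    (forall u v, u != v -> s v u = ~~ s u v) /\
    (forall u u' v v', e u u' -> e v v' ->
       [&& u != v, u != v', u' != v & u' != v'] -> parity_cell s n u u' v v').

(* The edge [w w'] is represented by a path from [r w] to [r w'] inside [S w w']; only
   disjoint edges need disjoint [S], so the paths may share their ends. *)
Lemma parity_planar_minor (V : finType) (W : eqType) (e : rel V) (f : rel W)
    (r : W -> V) (S : W -> W -> {set V}) :
    injective r ->
    (forall w w', f w w' ->
       connect [rel x y | [&& e x y, x \in S w w' & y \in S w w']]
         (r w) (r w')) ->
    (forall u u' v v', f u u' -> f v v' ->
       [&& u != v, u != v', u' != v & u' != v'] ->
       [disjoint S u u' & S v v']) ->
  parity_planar e -> parity_planar f.
Proof.
move=> rI conn dis [s [n [sC cells]]].
pose good w w' (pN : (nat -> V) * nat) :=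
  [/\ pN.1 0 = r w, pN.1 pN.2 = r w' &
   forall i, i < pN.2 -> [&& e (pN.1 i) (pN.1 i.+1),
     pN.1 i \in S w w' & pN.1 i.+1 \in S w w']].
have walk ww : exists pN, f ww.1 ww.2 -> good ww.1 ww.2 pN.
  case: ww => w w' /=.
  (* A dummy walk off the edges of [f] lets [choice] range over all pairs. *)
  case: (boolP (f w w')) => fw; last by exists (fun _ => r w, 0).
  have /connectP [p pth lst] := conn _ _ fw.
  exists (nth (r w) (r w :: p), size p) => _; split=> //.
    by rewrite lst -nth_last; case: (p).
  by move=> i ip; apply: (pathP (r w) pth).
have [P PP] := choice walk.
pose crossing w w' v := walk_crossing n (P (w, w')).1 (P (w, w')).2 (r v).
exists (fun u v => s (r u) (r v)), crossing; split=> [u v uv|u u' v v' uu vv d].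
  by apply: sC; rewrite (inj_eq rI).
have [pu pu' pS] := PP (u, u') uu; have [qv qv' qS] := PP (v, v') vv.
have D := dis _ _ _ _ uu vv d.
apply/eqP; rewrite /crossing -{}pu -{}pu' -{}qv -{}qv'.
apply: parity_walk => i j iN jM.
have /and3P [e1 a1 a2] := pS i iN; have /and3P [e2 b1 b2] := qS j jM.
apply: cells => //.
have ne x y : x \in S u u' -> y \in S v v' -> x != y.
  by move=> xS yS; apply: contraTneq xS => ->; rewrite (disjointFl D).
by rewrite !ne.
Qed.

(** Sum the relations over the fifteen pairs of disjoint edges. Each [n] term occurs twice and each
    pair of vertices six times. Every four vertices contribute an odd number of reversed orders, and
    there are five such quadruples, so the sum is 1 and not 0. *)
Lemma K5_not_parity_planar (V : eqType) (e : rel V) (x1 x2 x3 x4 x5 : V) :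
  uniq [:: x1; x2; x3; x4; x5] ->
  [&& e x1 x2, e x1 x3, e x1 x4, e x1 x5 & [&& e x2 x3, e x2 x4, e x2 x5,
    e x3 x4 & e x3 x5 && e x4 x5]] ->
  ~ parity_planar e.
Proof.
rewrite /= !inE !negb_or -!andbA.
move=> /and4P[d12 d13 d14 /and4P[d15 d23 d24 /and5P[d25 d34 d35 d45 _]]].
move=> /and4P[e12 e13 e14 /and4P[e15 e23 e24 /and4P[e25 e34 e35 e45]]].
move=> [s [n [sC cells]]].
pose c a b c' d := n a b c' (+) n a b d (+) (n c' d a (+) n c' d b) (+)
  (s a c' (+) s a d (+) (s b c' (+) s b d)).
have cE a b c' d : e a b -> e c' d -> a != c' -> a != d -> b != c' -> b != d ->
    c a b c' d = false.
  move=> ab cd n1 n2 n3 n4; have := cells _ _ _ _ ab cd.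
  by rewrite n1 n2 n3 n4 => /(_ isT) /eqP E; rewrite /c E addbb.
have sCf u v : u != v -> s v u = xorb true (s u v) by move=> /sC ->; case: (s u v).
suff: c x1 x2 x3 x4 (+) c x1 x2 x3 x5 (+) c x1 x2 x4 x5
  (+) c x1 x3 x2 x4 (+) c x1 x3 x2 x5 (+) c x1 x3 x4 x5
  (+) c x1 x4 x2 x3 (+) c x1 x4 x2 x5 (+) c x1 x4 x3 x5
  (+) c x1 x5 x2 x3 (+) c x1 x5 x2 x4 (+) c x1 x5 x3 x4
  (+) c x2 x3 x4 x5 (+) c x2 x4 x3 x5 (+) c x2 x5 x3 x4.
  by rewrite !cE // eq_sym.
rewrite /c (sCf _ _ d23) (sCf _ _ d24) (sCf _ _ d25) (sCf _ _ d34) (sCf _ _ d35)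
  (sCf _ _ d45) !addbE.
rewrite /is_true; btauto.
Qed.

(** The same count over eighteen pairs: [n] terms occur twice, pairs of vertices four or six times,
    and 27 orders are reversed, namely 18 with a [y] before an [x] and 9 between two [y]'s. *)
Lemma K33_not_parity_planar (V : eqType) (e : rel V) (x1 x2 x3 y1 y2 y3 : V) :
  uniq [:: x1; x2; x3; y1; y2; y3] ->
  [&& e x1 y1, e x1 y2, e x1 y3, e x2 y1 & [&& e x2 y2, e x2 y3, e x3 y1,
    e x3 y2 & e x3 y3]] ->
  ~ parity_planar e.
Proof.
rewrite /= !inE !negb_or -!andbA.
move=> /and5P[d12 d13 a11 a12 /and5P[a13 d23 a21 a22 /and5P[a23 a31 a32 a33]]].
move=> /and4P[b12 b13 b23 _].
move=> /and5P[e11 e12 e13 e21 /and5P[e22 e23 e31 e32 e33]].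
move=> [s [n [sC cells]]].
pose c a b c' d := n a b c' (+) n a b d (+) (n c' d a (+) n c' d b) (+)
  (s a c' (+) s a d (+) (s b c' (+) s b d)).
have cE a b c' d : e a b -> e c' d -> a != c' -> a != d -> b != c' -> b != d ->
    c a b c' d = false.
  move=> ab cd n1 n2 n3 n4; have := cells _ _ _ _ ab cd.
  by rewrite n1 n2 n3 n4 => /(_ isT) /eqP E; rewrite /c E addbb.
have sCf u v : u != v -> s v u = xorb true (s u v) by move=> /sC ->; case: (s u v).
suff: c x1 y1 x2 y2 (+) c x1 y1 x2 y3 (+) c x1 y1 x3 y2 (+) c x1 y1 x3 y3
  (+) c x1 y2 x2 y1 (+) c x1 y2 x2 y3 (+) c x1 y2 x3 y1 (+) c x1 y2 x3 y3
  (+) c x1 y3 x2 y1 (+) c x1 y3 x2 y2 (+) c x1 y3 x3 y1 (+) c x1 y3 x3 y2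
  (+) c x2 y1 x3 y2 (+) c x2 y1 x3 y3 (+) c x2 y2 x3 y1 (+) c x2 y2 x3 y3
  (+) c x2 y3 x3 y1 (+) c x2 y3 x3 y2.
  by rewrite !cE // eq_sym.
rewrite /c (sCf _ _ a21) (sCf _ _ a22) (sCf _ _ a23) (sCf _ _ a31) (sCf _ _ a32)
  (sCf _ _ a33) ?(sCf _ _ a12) ?(sCf _ _ a13) ?(sCf _ _ d12) ?(sCf _ _ d13)
  ?(sCf _ _ d23) ?(sCf _ _ b12) ?(sCf _ _ b13) ?(sCf _ _ b23) !addbE.
rewrite /is_true; btauto.
Qed.

(** * Dense graphs *)

Lemma parity_planar_sub (V : eqType) (e f : rel V) :
  subrel f e -> parity_planar e -> parity_planar f.
Proof.
move=> fe [s [n [sC cells]]]; exists s, n; split=> // u u' v v' /fe uu /fe vv.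
exact: cells.
Qed.

Definition arcs (V : finType) (e : rel V) : {set V * V} := [set p | e p.1 p.2].
Definition nbrs (V : finType) (e : rel V) (x : V) : {set V} := [set y | e x y].

Definition del_vertex (V : finType) (e : rel V) (y : V) : rel V :=
  [rel u v | [&& e u v, u != y & v != y]].

(** [y] stays in the vertex type as an isolated vertex; the vertices that count are later confined
    to a set [A]. *)
Definition contract (V : finType) (e : rel V) (x y : V) : rel V :=
  [rel u v | [&& u != y, v != y, u != v &
     [|| e u v, (u == x) && e y v | (v == x) && e y u]]].

Lemma card_arcs (V : finType) (e : rel V) : #|arcs e| = \sum_x #|nbrs e x|.
Proof.
rewrite -sum1_card (eq_bigl (fun p => e p.1 p.2)); last by move=> p; rewrite inE.
rewrite -(pair_big_dep xpredT (fun x y => e x y) (fun _ _ => 1)) /=.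
apply: eq_bigr => x _; rewrite -sum1_card; apply: eq_bigl => y.
by rewrite inE.
Qed.

Lemma card_arcs_del (V : finType) (e : rel V) (y : V) :
  symmetric e -> irreflexive e ->
  #|arcs e| = #|arcs (del_vertex e y)| + (#|nbrs e y|).*2.
Proof.
move=> eC eI.
have -> : arcs e = arcs (del_vertex e y) :|:
    (setX [set y] (nbrs e y) :|: setX (nbrs e y) [set y]).
  apply/setP => -[u v]; rewrite !inE /del_vertex /=.
  case: (eqVneq u y) => [->|uy] /=; case: (eqVneq v y) => [->|vy] /=;
    rewrite ?andbT ?andbF ?orbF ?orbT ?eI //; by rewrite eC.
rewrite !cardsU !cardsX !cards1 mul1n muln1.
rewrite (_ : _ :&: (_ :|: _) = set0) ?cards0 ?subn0; last first.
  apply/setP => -[u v]; rewrite !inE /del_vertex /=.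
  by case: (eqVneq u y) => [->|uy]; case: (eqVneq v y) => [->|vy];
    rewrite ?andbF ?andbT.
rewrite (_ : _ :&: _ = set0) ?cards0 ?subn0 ?addnn //.
apply/setP => -[u v]; rewrite !inE /del_vertex /=.
by case: (eqVneq u y) => [->|uy] //=; case: (eqVneq v y) => [->|vy];
  rewrite ?andbF ?eI.
Qed.

(** Contraction loses the edge itself and one of the two edges to each common neighbour; the edges
    from [y] to the set [M] of its other neighbours reappear at [x]. *)
Lemma card_arcs_contract (V : finType) (e : rel V) (x y : V) :
  symmetric e -> irreflexive e -> e x y ->
  #|arcs e| <= #|arcs (contract e x y)| + (#|nbrs e x :&: nbrs e y|.+1).*2.
Proof.
move=> eC eI exy; rewrite (card_arcs_del y) //.
have nxy : x != y by apply: contraTneq exy => ->; rewrite eI.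
pose M := nbrs e y :\: nbrs e x :\ x.
have cM : #|nbrs e y| = #|M| + (#|nbrs e x :&: nbrs e y|).+1.
  have := cardsID (nbrs e x) (nbrs e y); have := cardsD1 x (nbrs e y :\: nbrs e x).
  by rewrite !inE eI [e y x]eC exy setIC /= -/M; lia.
suff : #|arcs (del_vertex e y)| + (#|M|).*2 <= #|arcs (contract e x y)| by lia.
have c1 : #|arcs (del_vertex e y) :|: (setX [set x] M :|: setX M [set x])|
    = #|arcs (del_vertex e y)| + (#|M|).*2.
  rewrite !cardsU !cardsX !cards1 mul1n muln1.
  rewrite (_ : _ :&: (_ :|: _) = set0) ?cards0 ?subn0; last first.
    apply/setP => -[u v]; rewrite !inE /del_vertex /=.
    by case: (eqVneq u x) => [->|ux] /=; case: (eqVneq v x) => [->|vx] /=;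
      rewrite ?andbF ?andbT ?eI //= ?orbF; apply/negP => /and3P[] //;
      [move=> /and3P[->]|move=> /and3P[]; rewrite eC => ->].
  rewrite (_ : _ :&: _ = set0) ?cards0 ?subn0 ?addnn //.
  apply/setP => -[u v]; rewrite !inE /del_vertex /=.
  by case: (eqVneq u x) => [->|ux] //=; rewrite ?andbF.
rewrite -c1; apply/subset_leq_card/subsetP => -[u v]; rewrite !inE /del_vertex /contract /=.
case/or3P.
- move=> /and3P[uv -> ->]; rewrite uv andbT /=.
  by apply: contraTneq uv => ->; rewrite eI.
- move=> /andP[/eqP -> /and3P[vx _ yv]]; rewrite nxy eqxx yv orbT !andbT /=.
  by rewrite [x == v]eq_sym vx andbT; apply: contraTneq yv => ->; rewrite eI.
- move=> /andP[/and3P[ux _ yu] /eqP ->]; rewrite nxy eqxx yu !orbT ux !andbT.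
  by apply: contraTneq yu => ->; rewrite eI.
Qed.

(** A new edge is drawn as a path through [y]. It has [x] as an end, so two disjoint edges never
    both use [y]. *)
Lemma parity_planar_contract (V : finType) (e : rel V) (x y : V) :
  symmetric e -> e x y -> parity_planar e -> parity_planar (contract e x y).
Proof.
move=> eC exy.
pose S w w' := if e w w' then [set w; w'] else [set w; w'; y].
apply: (@parity_planar_minor _ _ _ _ id S) => //.
- move=> w w' /and4P[_ _ _ ww]; rewrite /S; case: ifP => [eww|neww].
    by apply: connect1; rewrite /= eww !inE !eqxx orbT.
  move: ww; rewrite neww /= => /orP[]/andP[/eqP E yw]; subst.
    apply: (@connect_trans _ _ y); apply: connect1 => /=.
      by rewrite exy !inE !eqxx !orbT.
    by rewrite yw !inE !eqxx !orbT.
  apply: (@connect_trans _ _ y); apply: connect1 => /=.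
    by rewrite eC yw !inE !eqxx !orbT.
  by rewrite eC exy !inE !eqxx !orbT.
move=> u u' v v' /and4P[uy u'y _ uu] /and4P[vy v'y _ vv] /and4P[d1 d2 d3 d4].
rewrite -setI_eq0; apply/eqP/setP => z; rewrite /S !inE.
have yE w : w != y -> (y == w) = false by rewrite eq_sym => /negbTE.
have {yE} yE := (yE _ uy, yE _ u'y, yE _ vy, yE _ v'y).
have D : (((z == u) || (z == u')) && ((z == v) || (z == v'))) = false.
  apply/negP => /andP[/orP[]/eqP -> ].
    by rewrite (negbTE d1) (negbTE d2).
  by rewrite (negbTE d3) (negbTE d4).
case: (eqVneq z y) => [->|zy]; last first.
  by case: ifP => _; case: ifP => _; rewrite !inE ?(negbTE zy) ?orbF D.
case: ifP uu => euu; case: ifP vv => evv; rewrite !inE ?yE //=.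
- by rewrite andbF.
move=> /orP[]/andP[/eqP ? _] /orP[]/andP[/eqP ? _]; subst;
  by rewrite ?eqxx in d1 d2 d3 d4.
Qed.

(** In a non-adjacent pair each vertex misses only the other one; if there is no such pair, any two
    vertices will do. *)
Lemma dominating_pair (V : finType) (e : rel V) (B : {set V}) :
    symmetric e ->
    {in B & &, forall u v w, uniq [:: u; v; w] -> e u v || e u w} -> 1 < #|B| ->
  exists p q, [/\ p \in B, q \in B, p != q &
    forall u, u \in B -> u != p -> u != q -> e p u /\ e q u].
Proof.
move=> eC one B1.
case: (pickP [pred z : V * V | [&& z.1 \in B, z.2 \in B, z.1 != z.2 &
    ~~ e z.1 z.2]]) => [[p q] /= /and4P[pB qB pq npq]|adj].
  exists p, q; split=> // u uB up uq; split.
    have := one p q u pB qB uB; rewrite (negbTE npq) /= !inE negb_or pq.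
    by rewrite [p == u]eq_sym up [q == u]eq_sym uq => ->.
  have := one q p u qB pB uB; rewrite eC (negbTE npq) /= !inE negb_or.
  by rewrite [q == p]eq_sym pq ![_ == u]eq_sym up uq => ->.
have [p [q [pB qB pq]]] := card_gt1P B1.
exists p, q; split=> // u uB up uq.
have := adj (p, u); have := adj (q, u).
rewrite /= pB qB uB ![_ == u]eq_sym up uq /=.
by move=> /negbFE -> /negbFE ->.
Qed.

(* Every vertex of [N] misses at most one other, so [x |: N] contains K_{3,3}. *)
Lemma dense5_not_parity_planar (V : finType) (e : rel V) (x : V) (N : {set V}) :
    symmetric e -> #|N| = 5 -> x \notin N -> {in N, forall u, e x u} ->
    {in N & &, forall u v w, uniq [:: u; v; w] -> e u v || e u w} ->
  ~ parity_planar e.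
Proof.
move=> eC N5 xN xA one.
have [|p [q [pN qN pq pqA]]] := dominating_pair eC one; first by rewrite N5.
have N'E : #|N :\ p :\ q| = 3.
  have := cardsD1 p N; have := cardsD1 q (N :\ p).
  by rewrite !inE pN qN eq_sym pq N5 /=; lia.
(* [r] and [s] come from the three vertices left; the last one, [t], completes a K_{3,3} with sides
   {p, q, t} and {r, s, x}. *)
have [||r [s [rN sN rs rsA]]] := @dominating_pair V e (N :\ p :\ q) eC.
- move=> u v w; rewrite !inE => /and3P[_ _ uN] /and3P[_ _ vN] /and3P[_ _ wN].
  exact: one.
- by rewrite N'E.
have /card_gt0P [t tN] : 0 < #|N :\ p :\ q :\ r :\ s|.
  have := cardsD1 r (N :\ p :\ q); have := cardsD1 s (N :\ p :\ q :\ r).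
  rewrite N'E; lia.
move: tN rN sN; rewrite !inE => /and5P[ts tr tq tp tN] /and3P[rq rp rN].
move=> /and3P[sq sp sN].
have [rt st] : e r t /\ e s t by apply: rsA => //; rewrite !inE tq tp tN.
have nx u : u \in N -> u != x by move=> uN; apply: contraNneq xN => <-.
have [pr qr] := pqA r rN rp rq; have [ps qs] := pqA s sN sp sq.
apply: (@K33_not_parity_planar _ e p q t r s x).
  rewrite /= !inE !negb_or pq rs !nx // [p == t]eq_sym tp [p == r]eq_sym rp.
  rewrite [p == s]eq_sym sp [q == t]eq_sym tq [q == r]eq_sym rq.
  by rewrite [q == s]eq_sym sq tr ts.
by rewrite pr ps qr qs [e t r]eC rt [e t s]eC st ![e _ x]eC !xA.
Qed.

Lemma dense4_not_parity_planar (V : finType) (e : rel V) (x : V) (N : {set V}) :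
    symmetric e -> #|N| = 4 -> x \notin N -> {in N, forall u, e x u} ->
    {in N &, forall u v, u != v -> e u v} ->
  ~ parity_planar e.
Proof.
move=> eC N4 xN xA adj.
have := enum_uniq (mem N); have := mem_enum N; move: N4; rewrite cardE.
case: (enum N) => [|a [|b [|c [|d []]]]] // _ mE U.
have [aN bN cN dN] : [/\ a \in N, b \in N, c \in N & d \in N].
  by rewrite -!mE !inE !eqxx !orbT.
have U5 : uniq [:: x; a; b; c; d] by rewrite /= in U *; rewrite U andbT mE.
apply: (K5_not_parity_planar U5); rewrite !xA //.
by move: U; rewrite /= !inE !negb_or => /and4P[/and3P[ab ac ad] /andP[bc bd] cd _];
  rewrite !adj.
Qed.

(* Minimal counterexample: every edge lies in at least three triangles and some vertex
   has degree 4 or 5, so its neighbourhood is dense. [arcs e] counts each edge twice. *)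
Lemma dense_not_parity_planar (V : finType) (A : {set V}) (e : rel V) :
    symmetric e -> irreflexive e -> (forall x y, e x y -> x \in A) ->
    2 < #|A| -> 6 * #|A| <= #|arcs e| + 10 ->
  ~ parity_planar e.
Proof.
have [m] := ubnP #|A|.
elim: m => // m IH in A e *; move=> lem.
have [k] := ubnP #|arcs e|.
elim: k => // k IHk in e *; move=> lek eC eI eA A2 dense pe.
have eA' x y : e x y -> y \in A by rewrite eC; apply: eA.
have NA x : nbrs e x \subset A :\ x.
  apply/subsetP => y; rewrite !inE => exy; rewrite (eA' _ _ exy) andbT.
  by apply: contraTneq exy => ->; rewrite eI.
have arcsE : #|arcs e| = \sum_(x in A) #|nbrs e x|.
  rewrite card_arcs [RHS]big_mkcond; apply: eq_bigr => x _.
  case: ifPn => // xA; apply/eqP; rewrite cards_eq0.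
  by apply/eqP/setP => y; rewrite !inE; apply: contraNF xA; apply: eA.
(* On three or four vertices even the complete graph has fewer than 3N - 5 edges. *)
have A5 : 4 < #|A|.
  have : #|arcs e| <= \sum_(x in A) #|A|.-1.
    rewrite arcsE; apply: leq_sum => x xA; apply: leq_trans (subset_leq_card (NA x)) _.
    by have := cardsD1 x A; rewrite xA; lia.
  by rewrite sum_nat_const; move: (#|A|) A2 dense => [|[|[|[|[|?]]]]] //; lia.
have cardD1 x : x \in A -> #|A :\ x| = #|A|.-1.
  by move=> xA; have := cardsD1 x A; rewrite xA; lia.
(* An edge to spare is deleted; afterwards there are exactly 3N - 5 edges. *)
case: (leqP (6 * #|A|) (#|arcs e| + 8)) => [dense'|sparse].
  have /card_gt0P [[x y]] : 0 < #|arcs e| by lia.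
  rewrite inE /= => exy.
  pose f := [rel u v | e u v && ((u, v) \notin [set (x, y); (y, x)])].
  have fe : subrel f e by move=> u v /andP[].
  have xy : x != y by apply: contraTneq exy => ->; rewrite eI.
  have cf : #|arcs e| = #|arcs f| + 2.
    rewrite -(cardsID [set (x, y); (y, x)]) addnC; congr (_ + _).
      by apply: eq_card => -[u v]; rewrite !inE /= !inE andbC.
    rewrite (setIidPr _) ?cards2 ?xpair_eqE ?(negbTE xy) //.
    by apply/subsetP => -[u v]; rewrite !inE => /orP[]/eqP[-> ->] //=; rewrite eC.
  apply: (IHk f) => //; try lia.
  - move=> u v; rewrite /= eC !inE !xpair_eqE [in RHS]orbC.
    by congr (_ && ~~ (_ || _)); rewrite andbC.
  - by move=> u; rewrite /= eI.
  - by move=> u v /fe; apply: eA.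
  - exact: parity_planar_sub pe.
(* Deleting a vertex of degree at most 3, or contracting an edge with at most two common neighbours,
   costs at most three edges, so the bound 3N - 5 survives. *)
case: (boolP [exists x in A, #|nbrs e x| <= 3]) => [/exists_inP [x xA d3]|/exists_inPn deg4].
  have c := card_arcs_del x eC eI.
  apply: (IH (A :\ x) (del_vertex e x)); rewrite ?cardD1 //; try lia.
  - by move=> u v; rewrite /del_vertex /= eC; congr (_ && _); rewrite andbC.
  - by move=> u; rewrite /del_vertex /= eI.
  - by move=> u v /and3P[/eA uA ux _]; rewrite !inE ux.
  - by apply: parity_planar_sub pe => u v /and3P[].
have com x y : e x y -> 2 < #|nbrs e x :&: nbrs e y|.
  move=> exy; rewrite ltnNge; apply/negP => c2.
  have c := card_arcs_contract eC eI exy.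
  have yA := eA' _ _ exy; have xA := eA _ _ exy.
  have xy : x != y by apply: contraTneq exy => ->; rewrite eI.
  apply: (IH (A :\ y) (contract e x y)); rewrite ?cardD1 //; try lia.
  - move=> u v; rewrite /contract /= eC [v == u]eq_sym; case: (u == y) (v == y) => [] [] //=.
    by congr (_ && (_ || _)); rewrite orbC.
  - by move=> u; rewrite /contract /= eqxx !andbF.
  - move=> u v /and4P[uy _ _ /or3P[/eA|/andP[/eqP -> _]|/andP[_ /eA']]];
      by rewrite !inE ?uy ?xy.
  - exact: parity_planar_contract.
(* The degree sum is below 6N, so some degree is at most 5. *)
have /existsP [x /andP[xA d5]] : [exists x, (x \in A) && (#|nbrs e x| <= 5)].
  rewrite -[X in is_true X]negbK; apply/negP => /existsPn small.
  have : \sum_(x in A) 6 <= #|arcs e|.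
    rewrite arcsE; apply: leq_sum => x xA.
    by have := small x; rewrite xA /= -ltnNge.
  by rewrite sum_nat_const; lia.
have {}deg4 := deg4 x xA; rewrite -ltnNge in deg4.
have xN : x \notin nbrs e x by rewrite inE eI.
have xNA : {in nbrs e x, forall u, e x u} by move=> u; rewrite inE.
have sub u : nbrs e x :&: nbrs e u \subset nbrs e x :\ u.
  apply/subsetP => v; rewrite !inE => /andP[-> uv]; rewrite andbT.
  by apply: contraTneq uv => ->; rewrite eI.
have cD u : e x u -> #|nbrs e x| = #|nbrs e x :\ u|.+1.
  by move=> xu; rewrite (cardsD1 u) inE xu.
(* In degree 4, three common neighbours are all the other neighbours, so the neighbourhood is
   complete. *)
have [d4|d4] := eqVneq #|nbrs e x| 4.
  apply: (dense4_not_parity_planar eC d4 xN xNA) pe => u v.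
  rewrite !inE => xu xv uv.
  have E : nbrs e x :&: nbrs e u = nbrs e x :\ u.
    by apply/eqP; rewrite eqEcard sub /=; have := cD u xu; have := com _ _ xu; lia.
  have : v \in nbrs e x :\ u by rewrite !inE eq_sym uv.
  by rewrite -E !inE => /andP[].
have {d4} d5' : #|nbrs e x| = 5 by lia.
apply: (dense5_not_parity_planar eC d5' xN xNA) pe => u v w.
rewrite !inE => xu xv xw /= /and3P[]; rewrite !inE negb_or => /andP[uv uw] vw _.
case: (boolP (e u v)) => //= nuv; apply: contraT => nuw.
(* A second non-neighbour [w] of [u] would leave two vertices of the neighbourhood for three common
   neighbours. *)
have : #|nbrs e x :&: nbrs e u| <= #|nbrs e x :\ u :\ v :\ w|.
  apply/subset_leq_card/subsetP => z; rewrite !inE => /andP[-> uz]; rewrite andbT.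
  by apply/and3P; split; apply: contraTneq uz => ->; rewrite ?eI.
have := com _ _ xu; have := cD u xu.
have := cardsD1 v (nbrs e x :\ u); have := cardsD1 w (nbrs e x :\ u :\ v).
by rewrite !inE xv xw ![_ == u]eq_sym uv uw [w == v]eq_sym vw /= d5'; clear; lia.
Qed.

(** * From plane drawings to mod-2 drawings *)

Section PlaneDrawings.
Import Order.TTheory GRing.Theory Num.Theory numFieldNormedType.Exports.
Local Open Scope classical_set_scope.
Local Open Scope ring_scope.
Variable R : realType.
Implicit Types p q r : R * R.

Definition lex_lt p q : bool := (p.1 < q.1) || (p.1 == q.1) && (p.2 < q.2).

(* Parity of the crossings of the short step [p p'] with the downward ray from [r]. *)
Definition ray_crossing p p' r : bool :=
  (lex_lt p r (+) lex_lt p' r) && (p.2 < r.2).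

Lemma lex_ltC p q : p != q -> lex_lt q p = ~~ lex_lt p q.
Proof.
case: p q => [a b] [c d]; rewrite xpair_eqE /lex_lt /=.
by case: (ltgtP a c) => //= _; case: (ltgtP b d).
Qed.

Lemma parity_cell_const p p' q q' b :
    [&& lex_lt p q == b, lex_lt p q' == b, lex_lt p' q == b & lex_lt p' q' == b] ->
    [&& p != q, p != q', p' != q & p' != q'] ->
  parity_cell lex_lt ray_crossing p p' q q'.
Proof.
move=> /and4P[/eqP e1 /eqP e2 /eqP e3 /eqP e4] /and4P[n1 n2 n3 n4].
rewrite /parity_cell /ray_crossing (lex_ltC n1) (lex_ltC n2) (lex_ltC n3).
by rewrite (lex_ltC n4) e1 e2 e3 e4 !addbb.
Qed.

(** With horizontal separation the order never changes, and both sides vanish. *)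
Lemma parity_cell_fst p p' q q' :
    [&& p.1 < q.1, p.1 < q'.1, p'.1 < q.1 & p'.1 < q'.1] ||
    [&& q.1 < p.1, q'.1 < p.1, q.1 < p'.1 & q'.1 < p'.1] ->
  parity_cell lex_lt ray_crossing p p' q q'.
Proof.
have ne (x y : R * R) : x.1 != y.1 -> x != y by apply: contraNneq => ->.
move=> /orP[]/and4P[h1 h2 h3 h4].
  apply: (@parity_cell_const _ _ _ _ true); first by rewrite /lex_lt h1 h2 h3 h4.
  by rewrite !ne // lt_eqF.
apply: (@parity_cell_const _ _ _ _ false).
  rewrite /lex_lt (lt_gtF h1) (lt_gtF h2) (lt_gtF h3) (lt_gtF h4).
  by rewrite (gt_eqF h1) (gt_eqF h2) (gt_eqF h3) (gt_eqF h4).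
by rewrite !ne // gt_eqF.
Qed.

(** With vertical separation only the rays from the upper points can be met, and each is met exactly
    when the order changes; the relation becomes an identity in the four orders. *)
Lemma parity_cell_snd p p' q q' :
    [&& p.2 < q.2, p.2 < q'.2, p'.2 < q.2 & p'.2 < q'.2] ||
    [&& q.2 < p.2, q'.2 < p.2, q.2 < p'.2 & q'.2 < p'.2] ->
  parity_cell lex_lt ray_crossing p p' q q'.
Proof.
have ne (x y : R * R) : x.2 != y.2 -> x != y by apply: contraNneq => ->.
have xorE (a b c d a' b' c' d' x y z w : bool) : a' = ~~ a -> b' = ~~ b ->
    c' = ~~ c -> d' = ~~ d -> [&& x, y, ~~ z & ~~ w] || [&& ~~ x, ~~ y, z & w] ->
    (a (+) c) && x (+) (b (+) d) && y (+)
      ((a' (+) b') && z (+) (c' (+) d') && w) == a (+) b (+) (c (+) d).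
  move=> -> -> -> -> /orP[]/and4P[]; last first.
    by move=> /negbTE -> /negbTE -> -> ->; case: a b c d => [] [] [] [].
  by move=> -> -> /negbTE -> /negbTE ->; case: a b c d => [] [] [] [].
rewrite /parity_cell /ray_crossing => lt_snd.
have [n1 n2 n3 n4] : [/\ p.2 != q.2, p.2 != q'.2, p'.2 != q.2 & p'.2 != q'.2].
  by rewrite !neq_lt; case/orP: lt_snd => /and4P[-> -> -> ->]; rewrite ?orbT.
apply: xorE; rewrite ?(lex_ltC (ne _ _ n1)) ?(lex_ltC (ne _ _ n2))
  ?(lex_ltC (ne _ _ n3)) ?(lex_ltC (ne _ _ n4)) //.
case/orP: lt_snd => /and4P[h1 h2 h3 h4].
  by rewrite h1 h2 (lt_gtF h1) (lt_gtF h3).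
by rewrite h1 h3 (lt_gtF h1) (lt_gtF h2).
Qed.

Lemma within_continuous_lt (g h : R -> R) (s t : R) :
    {within `[0, 1], continuous g} -> {within `[0, 1], continuous h} ->
    s \in `[0, 1] -> t \in `[0, 1] -> g s < h t ->
  exists2 d : R, 0 < d & forall x y, x \in `[0, 1] -> y \in `[0, 1] ->
    `|x - s| < d -> `|y - t| < d -> g x < h y.
Proof.
move=> /subspace_continuousP cg /subspace_continuousP ch sI tI gh.
pose m := (g s + h t) / 2.
have gm : g s < m by rewrite /m; lra.
have mh : m < h t by rewrite /m; lra.
have near_lt (f : R -> R) (z : R) (m' : set R) : f x @[x --> within `[0, 1] (nbhs z)] --> f z ->
    nbhs (f z) m' -> exists2 d : R, 0 < d &
    forall x, x \in `[0, 1] -> `|x - z| < d -> m' (f x).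
  move=> cf /cf; rewrite /within /= => /nbhs_ballP [d d0 db].
  by exists d => // x xI xz; apply: db => //; rewrite /ball /= distrC.
have [d1 d10 b1] := near_lt g s _ (cg s sI) (lt_nbhsl gm).
have [d2 d20 b2] := near_lt h t _ (ch t tI) (lt_nbhsr mh).
exists (Num.min d1 d2); first by rewrite lt_min d10.
move=> x y xI yI; rewrite !lt_min => /andP[x1 _] /andP[_ y2].
exact: lt_trans (b1 x xI x1) (b2 y yI y2).
Qed.

Lemma within_continuous_fst (f : R -> R * R) :
  {within `[0, 1], continuous f} -> {within `[0, 1], continuous (fst \o f)}.
Proof.
move=> /subspace_continuousP cf; apply/subspace_continuousP => x xI.
by apply: cvg_comp (cf x xI) _; apply: cvg_fst.
Qed.

Lemma within_continuous_snd (f : R -> R * R) :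
  {within `[0, 1], continuous f} -> {within `[0, 1], continuous (snd \o f)}.
Proof.
move=> /subspace_continuousP cf; apply/subspace_continuousP => x xI.
by apply: cvg_comp (cf x xI) _; apply: cvg_snd.
Qed.

(** Distinct points differ strictly in some coordinate, and by continuity this separation persists
    nearby. *)
Lemma local_parity_cell (f g : R -> R * R) (s t : R) :
    {within `[0, 1], continuous f} -> {within `[0, 1], continuous g} ->
    s \in `[0, 1] -> t \in `[0, 1] -> f s != g t ->
  exists2 d : R, 0 < d & forall x x' y y',
    [&& x \in `[0, 1], x' \in `[0, 1], y \in `[0, 1] & y' \in `[0, 1]] ->
    [&& `|x - s| < d, `|x' - s| < d, `|y - t| < d & `|y' - t| < d] ->
    parity_cell lex_lt ray_crossing (f x) (f x') (g y) (g y').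
Proof.
move=> cf cg sI tI fg.
have cf1 := within_continuous_fst cf; have cf2 := within_continuous_snd cf.
have cg1 := within_continuous_fst cg; have cg2 := within_continuous_snd cg.
have : ((f s).1 < (g t).1) || ((g t).1 < (f s).1) ||
    (((f s).2 < (g t).2) || ((g t).2 < (f s).2)).
  by rewrite -!neq_lt -negb_and -xpair_eqE -!surjective_pairing.
case/orP => /orP[] lt_fg.
- have [d d0 dP] := within_continuous_lt cf1 cg1 sI tI lt_fg.
  exists d => // x x' y y' /and4P[i1 i2 i3 i4] /and4P[? ? ? ?].
  by apply: parity_cell_fst; rewrite !dP.
- have [d d0 dP] := within_continuous_lt cg1 cf1 tI sI lt_fg.
  exists d => // x x' y y' /and4P[i1 i2 i3 i4] /and4P[? ? ? ?].
  by apply: parity_cell_fst; rewrite !dP ?orbT.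
- have [d d0 dP] := within_continuous_lt cf2 cg2 sI tI lt_fg.
  exists d => // x x' y y' /and4P[i1 i2 i3 i4] /and4P[? ? ? ?].
  by apply: parity_cell_snd; rewrite !dP.
- have [d d0 dP] := within_continuous_lt cg2 cf2 tI sI lt_fg.
  exists d => // x x' y y' /and4P[i1 i2 i3 i4] /and4P[? ? ? ?].
  by apply: parity_cell_snd; rewrite !dP ?orbT.
Qed.

Definition grid (N i : nat) : R := i%:R / N.+1%:R.

Lemma grid_itv N i : (i <= N.+1)%N -> grid N i \in `[0, 1].
Proof.
move=> iN; rewrite in_itv /= /grid divr_ge0 //= ler_pdivrMr ?ltr0n //.
by rewrite mul1r ler_nat.
Qed.

Lemma gridS N i : grid N i.+1 - grid N i = N.+1%:R^-1.
Proof. by rewrite /grid -mulrBl -natrB // subSnn mul1r. Qed.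

Lemma near_parity_cells (f g : R -> R * R) :
    {within `[0, 1], continuous f} -> {within `[0, 1], continuous g} ->
    (forall s t, s \in `[0, 1] -> t \in `[0, 1] -> f s != g t) ->
  \forall N \near \oo, forall i j, (i <= N)%N -> (j <= N)%N ->
    parity_cell lex_lt ray_crossing (f (grid N i)) (f (grid N i.+1))
      (g (grid N j)) (g (grid N j.+1)).
Proof.
move=> cf cg fg.
pose P (N : nat) (z : R * R) := forall x x' y y',
    [&& x \in `[0, 1], x' \in `[0, 1], y \in `[0, 1] & y' \in `[0, 1]] ->
    [&& `|x - z.1| <= N.+1%:R^-1, `|x' - z.1| <= N.+1%:R^-1,
      `|y - z.2| <= N.+1%:R^-1 & `|y' - z.2| <= N.+1%:R^-1] ->
    parity_cell lex_lt ray_crossing (f x) (f x') (g y) (g y').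
(* Compactness of the parameter square, in near-covering form, plays the role of a Lebesgue number:
   one mesh size serves all cells. *)
have /compact_near_coveringP cov :=
  compact_setX (@segment_compact R 0 1) (@segment_compact R 0 1).
have : \forall N \near \oo, `[0, 1] `*` `[0, 1] `<=` P N.
  apply: cov => -[s t] [/= sI tI].
  have [d d0 dP] := local_parity_cell cf cg sI tI (fg s t sI tI).
  have d20 : 0 < d / 2 by rewrite divr_gt0.
  have n1 := nbhsx_ballx (s, t) _ d20.
  have n2 := near_infty_natSinv_lt (PosNum d20).
  (* Half the radius for the base point and half for the mesh keep all four parameters within
     [d]. *)
  exists (ball (s, t) (d / 2), [set n | n.+1%:R^-1 < d / 2]); first by split.
  move=> [[s' t'] N] [/= [/= bs bt] nN] x x' y y' I4 /and4P[h1 h2 h3 h4].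
  have close (u v w : R) : ball v (d / 2) w -> `|u - w| <= N.+1%:R^-1 -> `|u - v| < d.
    rewrite /ball /= => vw uw; rewrite -(subrKA w) (splitr d).
    apply: le_lt_trans (ler_normD _ _) _.
    by rewrite ltrD ?(le_lt_trans uw nN) // distrC.
  apply: (dP _ _ _ _ I4); rewrite (close _ _ _ bs h1) (close _ _ _ bs h2).
  by rewrite (close _ _ _ bt h3) (close _ _ _ bt h4).
apply: filterS => N NP i j iN jN.
have n0 : `|grid N i - grid N i| <= N.+1%:R^-1 by rewrite subrr normr0.
have m0 : `|grid N j - grid N j| <= N.+1%:R^-1 by rewrite subrr normr0.
apply: (NP (grid N i, grid N j)); rewrite /= ?n0 ?m0 ?gridS ?ger0_norm ?lexx //.
  by split; apply: grid_itv; lia.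
by rewrite !grid_itv //; lia.
Qed.

(** Each edge is sampled on a fine grid. Disjoint edges have disjoint arcs, so all their cells
    satisfy the relation, and [parity_walk] adds these up to the relation between the edges. *)
Lemma planar_graph_parity (V : finType) (adj : V -> V -> Prop) :
  planar_graph R adj -> parity_planar [rel u v | `[< adj u v >]].
Proof.
move=> [pos [E [posI arcE _ crossE]]].
have param (uv : V * V) : exists f : R -> R * R, adj uv.1 uv.2 ->
    [/\ {within `[0, 1], continuous f}, f 0 = pos uv.1, f 1 = pos uv.2 &
      E uv.1 uv.2 = f @` `[0, 1]].
  have [a|na] := pselect (adj uv.1 uv.2); last by exists (fun _ => pos uv.1).
  by have [_ [f [cf _ f0 f1 Ef]]] := arcE _ _ a; exists f.
have [f fP] := choice param.
pose apart (w : (V * V) * (V * V)) :=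
  [&& w.1.1 != w.2.1, w.1.1 != w.2.2, w.1.2 != w.2.1 & w.1.2 != w.2.2].
have near_cells (w : (V * V) * (V * V)) : \forall N \near \oo,
    adj w.1.1 w.1.2 -> adj w.2.1 w.2.2 -> apart w ->
    forall i j, (i <= N)%N -> (j <= N)%N ->
    parity_cell lex_lt ray_crossing (f w.1 (grid N i)) (f w.1 (grid N i.+1))
      (f w.2 (grid N j)) (f w.2 (grid N j.+1)).
  have [[a1 a2 aw]|na] := pselect [/\ adj w.1.1 w.1.2, adj w.2.1 w.2.2 & apart w];
    last by apply: nearW => N a1 a2 aw; case: na.
  have [c1 _ _ E1] := fP _ a1; have [c2 _ _ E2] := fP _ a2.
  have dis s t : s \in `[0, 1] -> t \in `[0, 1] -> f w.1 s != f w.2 t.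
    move=> sI tI; apply/eqP => fst.
    have ne : [set w.1.1; w.1.2] <> [set w.2.1; w.2.2].
      move=> /seteqP[/(_ w.1.1 (or_introl erefl))] /= h _.
      by case/and4P: aw => n1 n2 _ _; case: h => /eqP; apply/negP.
    have [|z [h1 h2] _] := crossE _ _ _ _ a1 a2 ne (f w.1 s).
      by split; [rewrite E1; exists s|rewrite E2 fst; exists t].
    case/and4P: aw => n1 n2 n3 n4.
    by case: h1 h2 => /= -> [] /eqP; apply/negP.
  by apply: filterS (near_parity_cells c1 c2 dis) => N h _ _ _.
(* There are finitely many pairs of edges, so one [N] serves them all. *)
have [N NP] := filter_ex (filter_forall _ near_cells).
have g0 : grid N 0 = 0 by rewrite /grid mul0r.
have g1 : grid N N.+1 = 1 by rewrite /grid divff // pnatr_eq0.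
exists (fun u v => lex_lt (pos u) (pos v)), (fun u u' v =>
  walk_crossing ray_crossing (fun i => f (u, u') (grid N i)) N.+1 (pos v)).
split=> [u v uv|u u' v v' /asboolP uu /asboolP vv d].
  by apply: lex_ltC; rewrite (inj_eq posI).
have [_ f0 f1 _] := fP (u, u') uu; have [_ h0 h1 _] := fP (v, v') vv.
apply/eqP; rewrite -{}f0 -{}f1 -{}h0 -{}h1 -g0 -g1.
apply: (@parity_walk _ lex_lt ray_crossing (fun i => f (u, u') (grid N i))
  (fun i => f (v, v') (grid N i)) N.+1 N.+1) => i j iN jN.
exact: (NP ((u, u'), (v, v'))).
Qed.
End PlaneDrawings.

(** * Minors of Cayley graphs *)

Definition in_branch (V : finType) (W : eqType) (e : rel V) (label : V -> option W)
    (w : W) : rel V :=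
  [rel x y | [&& e x y, label x == Some w & label y == Some w]].

(** The branch sets of a minor are the fibres of [label], with [None] for deleted vertices. An edge
    is routed inside the union of its two branch sets, and these unions are disjoint for disjoint
    edges. *)
Lemma parity_planar_branch (V : finType) (W : eqType) (e : rel V) (f : rel W)
    (label : V -> option W) (r : W -> V) :
    symmetric e -> (forall w, label (r w) = Some w) ->
    (forall w x, label x = Some w -> connect (in_branch e label w) (r w) x) ->
    (forall w w', f w w' -> exists x y,
       [/\ label x = Some w, label y = Some w' & e x y]) ->
  parity_planar e -> parity_planar f.
Proof.
move=> eC lr conn edge.
pose S w w' := [set x | (label x == Some w) || (label x == Some w')].
apply: (@parity_planar_minor _ _ _ _ r S).
- by move=> w w' E; have := lr w; rewrite E lr => -[].
- move=> w w' fw; have [x [y [lx ly exy]]] := edge _ _ fw.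
  set g := [rel _ _ | _].
  have gC : symmetric g by move=> u v /=; rewrite eC; congr (_ && _); rewrite andbC.
  have sub u v w0 : (w0 == w) || (w0 == w') ->
      connect (in_branch e label w0) u v -> connect g u v.
    move=> w0P; apply: connect_sub => {}u {}v /and3P[euv lu lv].
    apply: connect1; rewrite /g /= euv !inE (eqP lu) (eqP lv) /=.
    by case/orP: w0P => /eqP ->; rewrite !eqxx ?orbT.
  apply: (connect_trans (sub _ _ w _ (conn _ _ lx))); first by rewrite eqxx.
  apply: (@connect_trans _ _ y).
    by apply: connect1; rewrite /g /= exy !inE lx ly !eqxx ?orbT.
  rewrite (sym_connect_sym gC); apply: (sub _ _ w' _ (conn _ _ ly)).
  by rewrite eqxx orbT.
- move=> u u' v v' _ _ /and4P[d1 d2 d3 d4]; rewrite -setI_eq0; apply/eqP/setP => x.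
  rewrite !inE; case: (label x) => [w|] //.
  rewrite !(inj_eq Some_inj); apply/negP => /andP[/orP[]/eqP ->].
    by rewrite (negbTE d1) (negbTE d2).
  by rewrite (negbTE d3) (negbTE d4).
Qed.

(* The cycle [v ^+ i], [i < p.*2], is cut into six arcs starting at these exponents;
   the opposite corners [m] and [m + 3] differ by the central element [v ^+ p]. *)
Definition hexagon_corners p : seq nat := [:: 0; 1; 2; p; p.+1; p.+2].

(** Arcs 2 and 5 absorb all remaining exponents; the other four are single points. *)
Definition hexagon_side p i : nat :=
  if i < 2 then i else if i < p then 2 else
  if i == p then 3 else if i == p.+1 then 4 else 5.

Lemma hexagon_side_lt p i : hexagon_side p i < 6.
Proof. by rewrite /hexagon_side; case: (ltnP i 2) => [i2|_]; [exact: leq_trans i2 _|do ![case: ifP]]. Qed.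

Lemma hexagon_sideE p : 2 < p ->
  [/\ hexagon_side p p.-1 = 2, hexagon_side p p = 3, hexagon_side p p.+1 = 4 &
      forall i, p.+1 < i -> hexagon_side p i = 5].
Proof.
move=> p2; have p1 := ltnW p2.
have F m : p <= m -> (m < 2) = false by move=> pm; rewrite ltnNge (leq_trans p1 pm).
rewrite /hexagon_side; split=> [|||i pi].
- by rewrite ltnNge -ltnS prednK ?(ltnW p1) // p2 /= leqnn.
- by rewrite F // ltnn eqxx.
- by rewrite F // ltnNge leqnSn gtn_eqF // eqxx.
- rewrite F ?(leq_trans _ pi) ?leqW // ltnNge (leq_trans _ pi) ?leqW //=.
  by rewrite !gtn_eqF // (leq_trans _ pi).
Qed.

(** This makes each arc connected, along powers of [v], to its corner. *)
Lemma hexagon_side_interval p i : 2 < p ->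
  nth 0 (hexagon_corners p) (hexagon_side p i) <= i /\
  forall j, nth 0 (hexagon_corners p) (hexagon_side p i) <= j <= i ->
    hexagon_side p j = hexagon_side p i.
Proof.
move=> p2; have [_ e3 e4 e5] := hexagon_sideE p2.
have [i2|i2] := ltnP i 2.
  have -> : hexagon_side p i = i by rewrite /hexagon_side i2.
  have -> : nth 0 (hexagon_corners p) i = i by case: i i2 => [|[]].
  split=> // j; rewrite -eqn_leq => /eqP <-.
  by rewrite /hexagon_side i2.
have [ip|ip] := ltnP i p.
  have E j : 1 < j -> j < p -> hexagon_side p j = 2.
    by move=> j1 jp; rewrite /hexagon_side jp ltnNge j1.
  rewrite E //=; split=> // j /andP[j2 ji]; apply: E => //.
  exact: leq_ltn_trans ji ip.
have [->|np] := eqVneq i p.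
  by rewrite e3 /=; split=> // j; rewrite -eqn_leq => /eqP <-.
have [->|np1] := eqVneq i p.+1.
  by rewrite e4 /=; split=> // j; rewrite -eqn_leq => /eqP <-.
have ip1 : p.+1 < i by rewrite ltn_neqAle eq_sym np1 ltn_neqAle eq_sym np.
by rewrite e5 //=; split=> // j /andP[jp _]; rewrite e5.
Qed.

Lemma hexagon_side_corner p m : 2 < p -> m < 6 ->
  nth 0 (hexagon_corners p) m < p.*2 /\
  hexagon_side p (nth 0 (hexagon_corners p) m) = m.
Proof.
move=> p2; have [_ e3 e4 e5] := hexagon_sideE p2.
have lt i : i < 3 -> p + i < p.*2 by move=> i3; rewrite -addnn ltn_add2l (leq_trans i3).
have lt3 i : i < 3 -> i < p.*2.
  by move=> i3; rewrite -addnn (leq_trans i3) // (leq_trans p2) // leq_addr.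
case: m => [|[|[|[|[|[|]]]]]] //= _.
- by split; [exact: lt3|].
- by split; [exact: lt3|].
- by split; [exact: lt3|rewrite /hexagon_side p2].
- by split; [rewrite -[p in p < _]addn0 lt|].
- by split; [rewrite -addn1 lt|].
- by split; [rewrite -addn2 lt|rewrite e5].
Qed.

Section CayleyGraphs.
Variable gT : finGroupType.
Implicit Types (T : {set gT}) (a b u v g h : gT).
Local Open Scope group_scope.

Definition cayley_rel T : rel gT :=
  [rel g h | (g != h) && ((g^-1 * h \in T) || (h^-1 * g \in T))].

Lemma cayley_rel_sym T : symmetric (cayley_rel T).
Proof. by move=> g h; rewrite /cayley_rel /= eq_sym orbC. Qed.

Lemma cayley_rel_irr T : irreflexive (cayley_rel T).
Proof. by move=> g; rewrite /cayley_rel /= eqxx. Qed.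

Lemma cayley_relR T g t : t \in T -> t != 1 -> cayley_rel T g (g * t).
Proof.
move=> tT t1; rewrite /cayley_rel /= mulKg tT andbT.
by rewrite -{1}[g]mulg1 (inj_eq (mulgI g)) eq_sym.
Qed.

Lemma sub_cayley_rel T T' :
  (forall t, t \in T -> (t \in T') || (t^-1 \in T')) ->
  subrel (cayley_rel T) (cayley_rel T').
Proof.
move=> TT g h /andP[gh /orP[]/TT]; rewrite invMg invgK => E;
by rewrite /cayley_rel /= gh //= orbC.
Qed.

Lemma card_arcs_cayley T :
  1 \notin T -> #|arcs (cayley_rel T)| = (#|gT| * #|T :|: T^-1|)%N.
Proof.
move=> T1; rewrite card_arcs -sum_nat_const; apply: eq_bigr => g _.
rewrite -(card_lcoset (T :|: T^-1) g); apply: eq_card => h.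
rewrite mem_lcoset !inE /cayley_rel /= invMg invgK.
case: eqVneq => [->|//]; by rewrite mulVg (negbTE T1).
Qed.

Lemma cayley_dense T :
    1 \notin T -> (2 < #|gT|)%N ->
    (6 * #|gT| <= #|gT| * #|T :|: T^-1| + 10)%N ->
  ~ parity_planar (cayley_rel T).
Proof.
move=> T1 g2 dense.
apply: (@dense_not_parity_planar _ setT).
- exact: cayley_rel_sym.
- exact: cayley_rel_irr.
- by [].
- by rewrite cardsT.
- by rewrite cardsT card_arcs_cayley.
Qed.

(** Degree at least 6 everywhere means at least 3N edges. *)
Lemma cayley_six T (s : seq gT) :
    1 \notin T -> uniq s -> {subset s <= T :|: T^-1} -> (5 < size s)%N ->
  ~ parity_planar (cayley_rel T).
Proof.
move=> T1 sU sT s5.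
have c6 : (5 < #|T :|: T^-1|)%N.
  rewrite -(card_uniqP sU) in s5; apply: leq_trans s5 _.
  exact/subset_leq_card/subsetP.
have c7 : (#|T :|: T^-1| < #|gT|)%N.
  rewrite -cardsT; apply/proper_card; rewrite properT; apply/negP => /eqP E.
  have : 1 \in T :|: T^-1 by rewrite E inE.
  by rewrite inE mem_invg invg1 orbb (negbTE T1).
apply: cayley_dense => //; first lia.
by apply: leq_trans (leq_addr _ _); rewrite mulnC leq_mul2l c6 orbT.
Qed.

Lemma connect_powers (W : eqType) T (label : gT -> option W) w g v n :
    v \in T -> v != 1 -> (forall j, (j <= n)%N -> label (g * v ^+ j) = Some w) ->
  connect (in_branch (cayley_rel T) label w) g (g * v ^+ n).
Proof.
move=> vT v1; elim: n => [|n IH] lw; first by rewrite expg0 mulg1.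
apply: connect_trans (IH _) _ => [j jn|]; first by apply: lw; lia.
by apply: connect1; rewrite /in_branch /= expgSr mulgA cayley_relR //= -mulgA
  -expgSr !lw ?eqxx //; lia.
Qed.

(** Branch set [m] is the arc [m] of the cycle [<[v]>], enlarged for [m] < 3 by the coset [v ^+ m *
    u * <[v]>]. The last hypothesis makes these three cosets distinct from each other and from
    [<[v]>]. *)
Lemma cayley_K33 T u v p :
    u \in T -> v \in T -> (2 < p)%N -> #[v] = p.*2 -> commute (v ^+ p) u ->
    (v ^+ 2) ^ u \notin <[v]> ->
  ~ parity_planar (cayley_rel T).
Proof.
move=> uT vT p2 ov zu vvu.
have vu : v ^ u \notin <[v]> by apply: contra vvu; rewrite conjXg; apply: groupX.
have uv : u \notin <[v]>.
  by apply: contra vvu => uv; rewrite groupJ // mem_cycle.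
have u1 : u != 1 by apply: contraNneq uv => ->; rewrite group1.
have v1 : v != 1 by rewrite -order_gt1 ov; lia.
(* On [<[v]>], [ex] is the discrete logarithm to base [v]. *)
pose pow i := v ^+ i; pose ex g := index g (mkseq pow p.*2).
pose arc := hexagon_side p; pose vs := hexagon_corners p.
have [arc2 arc3 arc4 arc5] := hexagon_sideE p2.
pose label g : option 'I_6 :=
  if g \in <[v]> then Some (inord (arc (ex g))) else
  if u^-1 * g \in <[v]> then Some (inord 0) else
  if (v * u)^-1 * g \in <[v]> then Some (inord 1) else
  if (v ^+ 2 * u)^-1 * g \in <[v]> then Some (inord 2) else None.
have labelV i : (i < p.*2)%N -> label (v ^+ i) = Some (inord (arc i)).
  move=> ip; rewrite /label mem_cycle; congr (Some (inord (arc _))).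
  rewrite /ex -[v ^+ i]/(pow i) -(nth_mkseq 1 pow ip) index_uniq ?size_mkseq //.
  apply/mkseq_uniqP => j k; rewrite !inE /pow => jp kp /eqP.
  by rewrite eq_expg_mod_order ov !modn_small // => /eqP.
have inV g k : (g * v ^+ k \in <[v]>) = (g \in <[v]>) by rewrite groupMr ?mem_cycle.
have Vin g k : (v ^+ k * g \in <[v]>) = (g \in <[v]>) by rewrite groupMl ?mem_cycle.
have label0 k : label (u * v ^+ k) = Some (inord 0).
  by rewrite /label inV (negbTE uv) mulKg mem_cycle.
have label1 k : label (v * u * v ^+ k) = Some (inord 1).
  have E1 : u^-1 * (v * u * v ^+ k) = v ^ u * v ^+ k by rewrite conjgE !mulgA.
  rewrite /label inV -[v in v * u]expg1 Vin (negbTE uv) expg1 E1 inV (negbTE vu).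
  by rewrite mulKg mem_cycle.
have label2 k : label (v ^+ 2 * u * v ^+ k) = Some (inord 2).
  have E1 : u^-1 * (v ^+ 2 * u * v ^+ k) = (v ^+ 2) ^ u * v ^+ k.
    by rewrite conjgE !mulgA.
  have E2 : (v * u)^-1 * (v ^+ 2 * u * v ^+ k) = v ^ u * v ^+ k.
    by rewrite conjgE invMg expgS expg1 -!mulgA mulKg.
  rewrite /label inV Vin (negbTE uv) E1 inV (negbTE vvu) E2 inV (negbTE vu).
  by rewrite mulKg mem_cycle.
pose r (w : 'I_6) := v ^+ nth 0%N vs w.
(* A hexagon with its three long diagonals is K_{3,3}, with the parities as sides. *)
pose f : rel 'I_6 := fun w w' => odd w != odd w'.
have ordE (w : 'I_6) m : w = m :> nat -> w = inord m.
  by move=> E; apply: val_inj; rewrite /= inordK -?E.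
have label_r w : label (r w) = Some w.
  have [lt side] := hexagon_side_corner p2 (ltn_ord w).
  by rewrite /r labelV //; congr Some; apply/esym/ordE; rewrite /arc side.
have conn w x : label x = Some w ->
    connect (in_branch (cayley_rel T) label w) (r w) x.
  move=> lx; have coset g k : (forall n, label (g * u * v ^+ n) = Some w) ->
      label g = Some w -> connect (in_branch (cayley_rel T) label w) g (g * u * v ^+ k).
    move=> lgu lg; apply: (@connect_trans _ _ (g * u)); last exact: connect_powers.
    apply: connect1; rewrite /in_branch /= cayley_relR // lg eqxx /=.
    by rewrite -[g * u]mulg1 -(expg0 v) lgu.
  case: (boolP (x \in <[v]>)) => [/cyclePmin [i]|xV].
    rewrite ov => ip xE; move: lx; rewrite xE labelV // => -[wE].
    have {}wE : w = arc i :> nat by rewrite -wE inordK // hexagon_side_lt.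
    have := hexagon_side_interval i p2; rewrite -/arc -wE => -[si li].
    have -> : v ^+ i = r w * v ^+ (i - nth 0%N vs w) by rewrite -expgD subnKC.
    apply: connect_powers => // j ji.
    have ji' : nth 0%N vs w + j <= i by rewrite -(subnKC si) leq_add2l.
    rewrite -expgD labelV; last exact: leq_ltn_trans ip.
    by congr Some; apply/esym/ordE; rewrite li // leq_addr.
  move: lx; rewrite /label (negbTE xV).
  case: ifP => [/cycleP [k xE]|_]; last case: ifP => [/cycleP [k xE]|_];
    last case: ifP => [/cycleP [k xE]|_] //.
  - case=> wE; have -> : x = r w * u * v ^+ k.
      by rewrite -xE -wE /r inordK // expg0 mul1g mulKVg.
    apply: coset => [n|]; last exact: label_r.
    by rewrite -wE /r inordK // expg0 mul1g label0.
  - case=> wE; have -> : x = r w * u * v ^+ k.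
      by rewrite -xE -wE /r inordK // expg1 mulKVg.
    apply: coset => [n|]; last exact: label_r.
    by rewrite -wE /r inordK // expg1 label1.
  - case=> wE; have -> : x = r w * u * v ^+ k.
      by rewrite -xE -wE /r inordK // mulKVg.
    apply: coset => [n|]; last exact: label_r.
    by rewrite -wE /r inordK // label2.
pose E (w w' : 'I_6) := exists x y,
  [/\ label x = Some w, label y = Some w' & cayley_rel T x y].
have EC w w' : E w w' -> E w' w.
  by move=> [x [y [lx ly xy]]]; exists y, x; rewrite cayley_rel_sym.
have pp : p.*2 = (p + p)%N by rewrite addnn.
have p0 : 0 < p by apply: leq_trans p2.
have rim i m m' : i.+1 <= p.*2 -> arc i = m -> arc (i.+1 %% p.*2) = m' ->
    E (inord m) (inord m').
  move=> ip <- <-; exists (v ^+ i), (v ^+ (i.+1 %% p.*2)).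
  rewrite !labelV ?ltn_mod ?double_gt0 //.
  by split=> //; rewrite -ov expg_mod_order expgSr cayley_relR.
have rim' i m m' : i.+1 < p.*2 -> arc i = m -> arc i.+1 = m' -> E (inord m) (inord m').
  by move=> ip im im'; apply: (rim i) => //; [exact: ltnW|rewrite modn_small].
(* Since [v ^+ p] commutes with [u], right multiplication by [u] takes the corner [v ^+ (p + m)] of
   arc [m + 3] into the coset attached to arc [m]. *)
have chord m : m < 3 -> E (inord m) (inord (m + 3)).
  move=> m3; apply: EC; exists (v ^+ (p + m)), (v ^+ (p + m) * u); split.
  - rewrite labelV; last by rewrite pp ltn_add2l (leq_trans m3).
    congr (Some (inord _)).
    by case: m m3 => [|[|[|]]] // _; rewrite /arc ?addn0 ?addn1 ?addn2 ?arc3 ?arc4 ?arc5.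
  - have -> : v ^+ (p + m) * u = v ^+ m * u * v ^+ p.
      by rewrite addnC expgD -mulgA zu mulgA.
    by case: m m3 => [|[|[|]]] // _; rewrite ?expg0 ?mul1g ?label0 ?expg1 ?label1 ?label2.
  - exact: cayley_relR.
have p2p m : m < 3 -> p + m < p.*2 by move=> m3; rewrite pp ltn_add2l (leq_trans m3).
have p3p m : m < 4 -> m < p.*2.
  by move=> m4; rewrite pp (leq_trans m4) // (leq_add p2 p0).
have r01 : E (inord 0) (inord 1) by apply: (rim' 0) => //; apply: p3p.
have r12 : E (inord 1) (inord 2).
  by apply: (rim' 1%N) => //; [exact: p3p|rewrite /arc /hexagon_side p2].
have r23 : E (inord 2) (inord 3).
  by apply: (rim' p.-1); rewrite ?prednK // -[p in p < _]addn0 p2p.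
have r34 : E (inord 3) (inord 4) by apply: (rim' p); rewrite // -addn1 p2p.
have r45 : E (inord 4) (inord 5).
  by apply: (rim' p.+1); rewrite /arc ?arc4 ?arc5 // -addn2 p2p.
have r50 : E (inord 5) (inord 0).
  have d0 : 0 < p.*2 by rewrite double_gt0.
  apply: (rim p.*2.-1); rewrite ?prednK // ?modnn //.
  by rewrite /arc arc5 // -ltnS prednK // -addn2 p2p.
have edge w w' : f w w' -> E w w'.
  have inE6 (x : 'I_6) : x = inord x by apply: ordE.
  wlog we : w w' / ~~ odd w => [H|] ww.
    case: (boolP (odd w)) => wo; last exact: H.
    by apply/EC/H; move: ww; rewrite /f wo; case: (odd w').
  have {ww} wo : odd w' by move: ww; rewrite /f (negbTE we); case: (odd w').
  rewrite (inE6 w) (inE6 w'); case: w w' we wo => [m lm] [m' lm'] /=.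
  case: m lm => [|[|[|[|[|[|]]]]]] //= _; case: m' lm' => [|[|[|[|[|[|]]]]]] //= _ _ _.
  - exact: (chord 0).
  - exact: EC.
  - exact: EC.
  - exact: (chord 2).
  - exact/EC/(chord 1%N).
  - exact: EC.
move=> /(parity_planar_branch (@cayley_rel_sym T) label_r conn edge).
apply: (@K33_not_parity_planar _ f (inord 0) (inord 2) (inord 4) (inord 1) (inord 3)
  (inord 5)).
  by rewrite -(map_inj_uniq val_inj) /= !inordK.
by rewrite /f !inordK.
Qed.

(* Branch sets: [1], [t], [b], [t * b] and the remaining powers of [b]. *)
Lemma cayley_K5 T t b :
    t \in T -> b \in T -> t * b \in T -> commute t b -> t ^+ 2 = 1 ->
    t \notin <[b]> -> (2 < #[b])%N ->
  ~ parity_planar (cayley_rel T).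
Proof.
move=> tT bT tbT tb t2 tB b2.
have tt : t * t = 1 by rewrite -t2 expgS expg1.
have t1 : t != 1 by apply: contraNneq tB => ->; rewrite group1.
have b1 : b != 1 by rewrite -order_gt1; lia.
have tbB : t * b \notin <[b]> by rewrite groupMr ?cycle_id.
have tb1 : t * b != 1 by apply: contraNneq tbB => ->; rewrite group1.
have ttb : (t * b == t) = false by rewrite -{2}[t]mulg1 (inj_eq (mulgI t)); apply/negbTE.
pose label g : option 'I_5 := if g \in <[b]> then
    (if g == 1 then Some (inord 0) else if g == b then Some (inord 2) else Some (inord 4))
  else if g == t then Some (inord 1) else if g == t * b then Some (inord 3) else None.
have label0 : label 1 = Some (inord 0) by rewrite /label group1 eqxx.
have label1 : label t = Some (inord 1) by rewrite /label (negbTE tB) eqxx.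
have label2 : label b = Some (inord 2) by rewrite /label cycle_id (negbTE b1) eqxx.
have label3 : label (t * b) = Some (inord 3) by rewrite /label (negbTE tbB) ttb eqxx.
have label4 i : (1 < i < #[b])%N -> label (b ^+ i) = Some (inord 4).
  move=> ib; have ne m : (m < 2)%N -> (b ^+ i == b ^+ m) = false.
    move=> m2; have [i1 ib'] := andP ib.
    rewrite eq_expg_mod_order !modn_small // ?(leq_trans m2 (ltnW b2)) //.
    by rewrite gtn_eqF // (leq_trans m2).
  have := ne 0%N isT; have := ne 1%N isT.
  by rewrite expg0 expg1 /label mem_cycle => -> ->.
pose r (w : 'I_5) := nth 1 [:: 1; t; b; t * b; b ^+ 2] w.
have ordE (w : 'I_5) m : w = m :> nat -> w = inord m.
  by move=> E; apply: val_inj; rewrite /= inordK -?E.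
have label_r w : label (r w) = Some w.
  have -> : Some w = Some (inord w) by congr Some; apply: ordE.
  by case: w => -[|[|[|[|[|]]]]] //= lm; rewrite /r ?label4.
have conn w x : label x = Some w ->
    connect (in_branch (cayley_rel T) label w) (r w) x.
  rewrite {1}/label; case: ifP => [/cyclePmin [i ib ->]|_].
    case: eqVneq => [E [<-]|n1]; first by rewrite E /r inordK // connect0.
    case: eqVneq => [E [<-]|nb [wE]]; first by rewrite E /r inordK // connect0.
    have i1 : (1 < i)%N by case: (i) n1 nb => [|[|]] //; rewrite ?expg0 ?expg1 eqxx.
    have -> : b ^+ i = b ^+ 2 * b ^+ (i - 2) by rewrite -expgD subnKC.
    rewrite -wE {1}/r inordK //=.
    apply: connect_powers => // j ji; rewrite -expgD label4 //=.
    by apply: leq_ltn_trans ib; rewrite -(subnKC i1) leq_add2l.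
  case: eqVneq => [-> [<-]|_]; first by rewrite /r inordK // connect0.
  by case: eqVneq => [-> [<-]|//]; rewrite /r inordK // connect0.
pose E (w w' : 'I_5) := exists x y,
  [/\ label x = Some w, label y = Some w' & cayley_rel T x y].
have EC w w' : E w w' -> E w' w.
  by move=> [x [y [lx ly xy]]]; exists y, x; rewrite cayley_rel_sym.
have link g h s m m' : label g = Some (inord m) -> label h = Some (inord m') ->
    s \in T -> s != 1 -> h = g * s -> E (inord m) (inord m').
  by move=> lg lh sT s1 hE; exists g, h; rewrite hE cayley_relR // -hE.
have bV : label b^-1 = Some (inord 4).
  have -> : b^-1 = b ^+ #[b].-1 by rewrite -invg_expg.
  by apply: label4; rewrite ltn_predL order_gt0 andbT -ltnS prednK.
have b2L : label (b ^+ 2) = Some (inord 4) by apply: label4.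
have e01 : E (inord 0) (inord 1) by apply: (link 1 t t); rewrite ?mul1g.
have e02 : E (inord 0) (inord 2) by apply: (link 1 b b); rewrite ?mul1g.
have e03 : E (inord 0) (inord 3) by apply: (link 1 (t * b) (t * b)); rewrite ?mul1g.
have e04 : E (inord 0) (inord 4) by apply/EC/(link b^-1 1 b); rewrite ?mulVg.
have e12 : E (inord 1) (inord 2).
  by apply: (link t b (t * b)); rewrite // mulgA tt mul1g.
have e13 : E (inord 1) (inord 3) by apply: (link t (t * b) b).
have e14 : E (inord 1) (inord 4) by apply/EC/(link b^-1 t (t * b)); rewrite // tb mulKg.
have e23 : E (inord 2) (inord 3) by apply: (link b (t * b) t); rewrite // tb.
have e24 : E (inord 2) (inord 4) by apply: (link b (b ^+ 2) b).
have e34 : E (inord 3) (inord 4).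
  by apply: (link (t * b) (b ^+ 2) (t * b)); 
    rewrite // expgS expg1 -mulgA [b * (t * b)]mulgA -tb !mulgA tt mul1g.
pose f : rel 'I_5 := fun w w' => w != w'.
have edge w w' : f w w' -> E w w'.
  have inE5 (x : 'I_5) : x = inord x by apply: ordE.
  wlog ww : w w' / (w < w')%N => [H|_].
    rewrite /f -(inj_eq val_inj) neq_ltn => /orP[]ww.
      by apply: H; rewrite // /f -(inj_eq val_inj) /= ltn_eqF.
    by apply/EC/H; rewrite // /f -(inj_eq val_inj) /= ltn_eqF.
  rewrite (inE5 w) (inE5 w'); case: w w' ww => [m lm] [m' lm'] /=.
  by case: m lm => [|[|[|[|[|]]]]] //= _; case: m' lm' => [|[|[|[|[|]]]]].
move=> /(parity_planar_branch (@cayley_rel_sym T) label_r conn edge).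
have U : uniq [:: inord 0; inord 1; inord 2; inord 3; inord 4 : 'I_5].
  by rewrite -(map_inj_uniq val_inj) /= !inordK.
apply: (K5_not_parity_planar U).
by rewrite /f -!(inj_eq val_inj) /= !inordK.
Qed.

(** The steps of the graph contracted along [(a, i0)]. The generator [(x, i0)] acts as [x] from
    layer [i0] and as [a^-1 * x] from another layer; [(y, i)] with [i != i0] acts as [y * a] from
    layer [i0] and as [y ^ a] from another layer. *)
Definition right_group_step (k : nat) (C : gT -> 'I_k -> Prop) (a : gT) (i0 : 'I_k)
    (t : gT) : Prop :=
  (exists2 x, C x i0 & t = x \/ t = a^-1 * x) \/
  (exists y i, [/\ i != i0, C y i & t = y * a \/ t = y ^ a]).

(* The vertex [(g, i)] with [i != i0] is merged into [(g * a, i0)]. *)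
Lemma right_group_contract k (C : gT -> 'I_k -> Prop) (e : rel (gT * 'I_k))
    a (i0 : 'I_k) T :
    symmetric e ->
    (forall g i c j, C c j -> (g, i) != (g * c, j) -> e (g, i) (g * c, j)) ->
    (1 < k)%N -> C a i0 -> (forall t, t \in T -> right_group_step C a i0 t) ->
  parity_planar e -> parity_planar (cayley_rel T).
Proof.
move=> eC Ce k1 Ca TC.
pose label (x : gT * 'I_k) := Some (if x.2 == i0 then x.1 else x.1 * a).
have [i1 i10] : exists i1, i1 != i0.
  have : (0 < #|[set~ i0]|)%N by rewrite cardsC1 card_ord; lia.
  by case/card_gt0P => i1; rewrite !inE; exists i1.
have step t g : t \in T -> g != g * t -> exists x y,
    [/\ label x = Some g, label y = Some (g * t) & e x y].
  move=> tT gt; case: (TC t tT) => [[x Cx [E|E]]|[y [i [ii0 Cy [E|E]]]]]; subst t.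
  - exists (g, i0), (g * x, i0); rewrite /label /= eqxx; split=> //.
    by apply: Ce => //; rewrite xpair_eqE (negbTE gt).
  - exists (g * a^-1, i1), (g * a^-1 * x, i0).
    rewrite /label /= eqxx (negbTE i10) mulgKV !mulgA; split=> //.
    by apply: Ce => //; rewrite xpair_eqE (negbTE i10) andbF.
  - exists (g, i0), (g * y, i); rewrite /label /= eqxx (negbTE ii0) !mulgA.
    by split=> //; apply: Ce => //; rewrite xpair_eqE [i0 == i]eq_sym (negbTE ii0) andbF.
  - exists (g * a^-1, i), (g * a^-1 * y, i).
    rewrite /label /= (negbTE ii0) mulgKV conjgE !mulgA; split=> //.
    apply: Ce => //; rewrite xpair_eqE eqxx andbT.
    by apply: contraNneq gt => E; rewrite conjgE !mulgA -E mulgKV.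
apply: (@parity_planar_branch _ _ _ _ label (fun g => (g, i0))) => //.
- by move=> g; rewrite /label /= eqxx.
- move=> g [h i]; rewrite /label /=; case: eqVneq => [->|ii0] [<-] //.
  apply: connect1; rewrite /in_branch /= eqxx (negbTE ii0) eqxx !andbT eC.
  by apply: Ce => //; rewrite xpair_eqE (negbTE ii0) andbF.
- move=> g h /andP[gh /orP[] tT].
    by have := step _ g tT; rewrite mulKVg; apply.
  have := step _ h tT; rewrite mulKVg eq_sym => /(_ gh) [x [y [lx ly xy]]].
  by exists y, x; rewrite eC.
Qed.

End CayleyGraphs.

(** * Generators of a right group *)

Section RightGroups.
Variable gT : finGroupType.
Local Open Scope group_scope.
Implicit Types (a b u v w x y t g h : gT).

(** The two steps that a further generator [x] contributes after contraction along [a]; in the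
    second case [x * a = a * x ^ a]. *)
Definition twist_pair a x u w : Prop :=
  (u = x \/ u = x ^ a) /\ (w = a^-1 * u \/ w = a * u).

Lemma right_group_step_pair k (C : gT -> 'I_k -> Prop) a i0 x i :
    C a i0 -> C x i ->
  exists u w, [/\ twist_pair a x u w, right_group_step C a i0 u &
    right_group_step C a i0 w].
Proof.
move=> Ca Cx; case: (eqVneq i i0) => [E|ii0].
  subst i; exists x, (a^-1 * x); split.
  - by split; left.
  - by left; exists x => //; left.
  - by left; exists x => //; right.
exists (x ^ a), (a * x ^ a); split.
- by split; right.
- by right; exists x, i; split=> //; right.
- by right; exists x, i; split=> //; left; rewrite conjgE !mulgA mulgV mul1g.
Qed.

(** Subgroups containing [a] cannot tell [u], [w] and [x] apart; hence independence of the
    generators separates the pairs. *)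
Lemma twist_pair_mem a x u w (K : {group gT}) :
  twist_pair a x u w -> a \in K -> (u \in K = (x \in K)) /\ (w \in K = (x \in K)).
Proof.
move=> [uE wE] aK; have uK : u \in K = (x \in K).
  by case: uE => ->; rewrite ?groupJr.
by split=> //; case: wE => ->; rewrite groupMl ?groupV.
Qed.

Lemma twist_pair_neq a x u w : twist_pair a x u w -> a != 1 -> u != w.
Proof.
move=> [_ wE] a1; rewrite -{1}[u]mul1g.
by case: wE => ->; rewrite (inj_eq (mulIg u)) eq_sym ?invg_eq1.
Qed.

Lemma twist_pair_inv a x u w :
  twist_pair a x u w -> a \notin <[x]> -> u^-1 != w.
Proof.
move=> [uE wE] ax; have aU : a \notin <[u]>.
  by case: uE => ->; rewrite // cycleJ mem_conjg conjgE invgK mulgV mulg1.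
apply: contraNneq aU => E; case: wE E => -> E.
  by rewrite -(mulgKV u a) E mulKVg groupM ?cycle_id.
by rewrite -(mulgK u a) -E groupM ?groupV ?cycle_id.
Qed.

(** If [a], [u] and their product have square 1, then [a] and [u] commute, so the conjugation by [a]
    is trivial and [u = x]. *)
Lemma twist_pair_commute a x u w :
  twist_pair a x u w -> a ^+ 2 = 1 -> u ^+ 2 = 1 -> w ^+ 2 = 1 ->
  x ^+ 2 = 1 /\ commute a x.
Proof.
move=> [uE wE] a2 u2 w2.
have V y : y ^+ 2 = 1 -> y^-1 = y.
  by move=> y2; apply/eqP; rewrite eq_invg_mul -{2}[y]expg1 -expgS y2.
have aV := V _ a2; have uV := V _ u2; have wV := V _ w2.
have {}wE : w = a * u by case: wE => ->; rewrite ?aV.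
have au : commute a u by rewrite /commute -wE -wV wE invMg aV uV.
suff <- : u = x by [].
case: uE => // uE; rewrite -[x](conjgK a) -uE.
by rewrite conjgE aV aV -au mulgA -{1}aV mulVg mul1g.
Qed.

(** The five steps are distinct, so a sixth neighbour arises unless all are involutions. The graph
    is then 5-regular, which is too dense when N is at most 10. *)
Lemma twist_pairs_cayley a x1 x2 u1 w1 u2 w2 :
    twist_pair a x1 u1 w1 -> twist_pair a x2 u2 w2 ->
    a \notin <[x1]> -> a \notin <[x2]> -> x1 \notin <[a]> -> x2 \notin <[a]> ->
    x2 \notin <<[set a; x1]>> ->
    parity_planar (cayley_rel [set:: [:: a; u1; w1; u2; w2]]) ->
  [/\ a ^+ 2 = 1, x1 ^+ 2 = 1, commute a x1, x2 ^+ 2 = 1 & commute a x2 /\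
    10 < #|gT|].
Proof.
move=> p1 p2 a1 a2 x1a x2a x21 pp.
set T := [set:: _] in pp.
have an1 : a != 1 by apply: contraNneq a1 => ->; rewrite group1.
have aA : a \in <[a]> by rewrite cycle_id.
have [u1A w1A] := twist_pair_mem p1 aA; have [u2A w2A] := twist_pair_mem p2 aA.
have aK : a \in <<[set a; x1]>> by rewrite mem_gen // !inE eqxx.
have x1K : x1 \in <<[set a; x1]>> by rewrite mem_gen // !inE eqxx orbT.
have [u1K w1K] := twist_pair_mem p1 aK; have [u2K w2K] := twist_pair_mem p2 aK.
rewrite {}x1K in u1K w1K; rewrite (negbTE x21) in u2K w2K.
rewrite (negbTE x1a) in u1A w1A; rewrite (negbTE x2a) in u2A w2A.
have neP (K : {group gT}) g h : g \in K -> h \in K = false -> (g == h) = false.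
  by move=> gK hK; apply: contraFF hK => /eqP <-.
have U : uniq [:: a; u1; w1; u2; w2].
  rewrite /= !inE !negb_or (twist_pair_neq p1) // (twist_pair_neq p2) //.
  rewrite (neP _ _ _ aA u1A) (neP _ _ _ aA w1A) (neP _ _ _ aA u2A) (neP _ _ _ aA w2A).
  rewrite (neP _ _ _ u1K u2K) (neP _ _ _ u1K w2K) (neP _ _ _ w1K u2K).
  by rewrite (neP _ _ _ w1K w2K).
have T1 : 1 \notin T.
  rewrite inE /= !inE !negb_or eq_sym an1.
  have ne1 g : g \in <[a]> = false -> 1 != g by move=> ga; rewrite (neP _ _ _ (group1 _) ga).
  by rewrite !ne1.
(* If [t] is not an involution, [t^-1] is a sixth element: [<[a]>] and [<<[set a; x1]>>] separate it
   from the other steps, except from its own partner, which [twist_pair_inv] handles. *)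
have inv t : t \in T -> t ^+ 2 = 1.
  move=> tT; apply/eqP; rewrite -[_ == _]negbK; apply/negP => t2.
  have tV : t^-1 != t.
    by apply: contraNneq t2 => E; rewrite expgS expg1 -{1}E mulVg.
  apply: (@cayley_six _ T (t^-1 :: [:: a; u1; w1; u2; w2])) pp => //.
    rewrite cons_uniq U andbT; apply/negP.
    have VA g : (g^-1 \in <[a]>) = (g \in <[a]>) by rewrite groupV.
    have VK g : (g^-1 \in <<[set a; x1]>>) = (g \in <<[set a; x1]>>) by rewrite groupV.
    have neM (K : {group gT}) g h : (g \in K) = ~~ (h \in K) -> (g == h) = false.
      by move=> E; apply/eqP => gh; move: E; rewrite gh; case: (h \in K).
    have nA := neM <[a]>%G; have nK := neM <<[set a; x1]>>%G.
    have i1 := twist_pair_inv p1 a1; have i2 := twist_pair_inv p2 a2.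
    have i1' : w1^-1 != u1 by rewrite eq_sym -(can2_eq invgK invgK).
    have i2' : w2^-1 != u2 by rewrite eq_sym -(can2_eq invgK invgK).
    move: tT tV; rewrite inE /= !inE => /orP[/eqP->|/orP[/eqP->|/orP[/eqP->|/orP[]/eqP->]]] tV.
    - rewrite (negbTE tV) (nA _ u1) ?(nA _ w1) ?(nA _ u2) ?(nA _ w2) //;
        by rewrite VA aA ?u1A ?w1A ?u2A ?w2A.
    - rewrite (negbTE tV) (negbTE i1) (nA _ a) ?(nK _ u2) ?(nK _ w2) //;
        by rewrite ?VA ?VK ?aA ?u1A ?u1K ?u2K ?w2K.
    - rewrite (negbTE tV) (negbTE i1') (nA _ a) ?(nK _ u2) ?(nK _ w2) //;
        by rewrite ?VA ?VK ?aA ?w1A ?w1K ?u2K ?w2K.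
    - rewrite (negbTE tV) (negbTE i2) (nA _ a) ?(nK _ u1) ?(nK _ w1) //;
        by rewrite ?VA ?VK ?aA ?u2A ?u2K ?u1K ?w1K.
    - rewrite (negbTE tV) (negbTE i2') (nA _ a) ?(nK _ u1) ?(nK _ w1) //;
        by rewrite ?VA ?VK ?aA ?w2A ?w2K ?u1K ?w1K.
  move=> g; rewrite in_cons => /orP[/eqP ->|gT0]; rewrite in_setU.
    by rewrite mem_invg invgK tT orbT.
  by rewrite inE gT0.
have inT g : g \in [:: a; u1; w1; u2; w2] -> g ^+ 2 = 1 by move=> gl; apply: inv; rewrite inE.
have [aa uu1 ww1] : [/\ a ^+ 2 = 1, u1 ^+ 2 = 1 & w1 ^+ 2 = 1].
  by split; apply: inT; rewrite !inE eqxx ?orbT.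
have [uu2 ww2] : u2 ^+ 2 = 1 /\ w2 ^+ 2 = 1.
  by split; apply: inT; rewrite !inE eqxx ?orbT.
have [xx1 ax1] := twist_pair_commute p1 aa uu1 ww1.
have [xx2 ax2] := twist_pair_commute p2 aa uu2 ww2.
split=> //; split=> //; rewrite ltnNge; apply/negP => g10.
have T5 : #|T| = 5%N by rewrite cardsE (card_uniqP U).
have c5 : (5 <= #|T :|: T^-1|)%N.
  by rewrite -T5; apply/subset_leq_card/subsetUl.
have g5 : (5 <= #|gT|)%N by rewrite -T5; apply: max_card.
apply: (cayley_dense T1 _ _ pp); first exact: leq_trans g5.
apply: (@leq_trans (#|gT| * 5 + 10)); last by rewrite leq_add2r leq_mul2l c5 orbT.
by move: g10; clear; lia.
Qed.

(** With four independent generators the three twist pairs alone are six distinct steps. *)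
Lemma six_twists_cayley a x1 x2 x3 u1 w1 u2 w2 u3 w3 :
    twist_pair a x1 u1 w1 -> twist_pair a x2 u2 w2 -> twist_pair a x3 u3 w3 ->
    a != 1 -> x1 \notin <[a]> -> x2 \notin <[a]> -> x3 \notin <[a]> ->
    x2 \notin <<[set a; x1]>> -> x3 \notin <<[set a; x1]>> ->
    x3 \notin <<[set a; x2]>> ->
  ~ parity_planar (cayley_rel [set:: [:: u1; w1; u2; w2; u3; w3]]).
Proof.
move=> p1 p2 p3 an1 x1a x2a x3a x21 x31 x32.
have aA : a \in <[a]> by rewrite cycle_id.
have [u1A w1A] := twist_pair_mem p1 aA; have [u2A w2A] := twist_pair_mem p2 aA.
have [u3A w3A] := twist_pair_mem p3 aA.
have aK : a \in <<[set a; x1]>> by rewrite mem_gen // !inE eqxx.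
have x1K : x1 \in <<[set a; x1]>> by rewrite mem_gen // !inE eqxx orbT.
have [u1K w1K] := twist_pair_mem p1 aK; have [u2K w2K] := twist_pair_mem p2 aK.
have [u3K w3K] := twist_pair_mem p3 aK.
have aL : a \in <<[set a; x2]>> by rewrite mem_gen // !inE eqxx.
have x2L : x2 \in <<[set a; x2]>> by rewrite mem_gen // !inE eqxx orbT.
have [u2L w2L] := twist_pair_mem p2 aL; have [u3L w3L] := twist_pair_mem p3 aL.
rewrite {}x1K in u1K w1K; rewrite (negbTE x21) in u2K w2K.
rewrite {}x2L in u2L w2L; rewrite (negbTE x32) in u3L w3L.
rewrite (negbTE x31) in u3K w3K; rewrite (negbTE x3a) in u3A w3A.
rewrite (negbTE x1a) in u1A w1A; rewrite (negbTE x2a) in u2A w2A.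
have neP (K : {group gT}) g h : g \in K -> h \in K = false -> (g == h) = false.
  by move=> gK hK; apply: contraFF hK => /eqP <-.
apply: (@cayley_six _ _ [:: u1; w1; u2; w2; u3; w3]) => //.
- rewrite inE /= !inE !negb_or.
  have ne1 g : g \in <[a]> = false -> 1 != g by move=> ga; rewrite (neP _ _ _ (group1 _) ga).
  by rewrite !ne1.
- rewrite /= !inE !negb_or (twist_pair_neq p1) // (twist_pair_neq p2) //.
  rewrite (twist_pair_neq p3) //.
  rewrite (neP _ _ _ u1K u2K) (neP _ _ _ u1K w2K) (neP _ _ _ w1K u2K).
  rewrite (neP _ _ _ w1K w2K) (neP _ _ _ u1K u3K) (neP _ _ _ u1K w3K).
  rewrite (neP _ _ _ w1K u3K) (neP _ _ _ w1K w3K) (neP _ _ _ u2L u3L).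
  by rewrite (neP _ _ _ u2L w3L) (neP _ _ _ w2L u3L) (neP _ _ _ w2L w3L).
- by move=> g gl; rewrite in_setU inE gl.
Qed.

Lemma card_three_involutions x y z :
    x ^+ 2 = 1 -> y ^+ 2 = 1 -> z ^+ 2 = 1 ->
    commute x y -> commute x z -> commute y z ->
  (#|<<[set x; y; z]>>| <= 8)%N.
Proof.
move=> x2 y2 z2 xy xz yz.
have o2 g : g ^+ 2 = 1 -> (#|<[g]>| <= 2)%N.
  by move=> g2; rewrite -orderE dvdn_leq // order_dvdn g2.
have xyE : <[x]> <*> <[y]> = <[x]> * <[y]>.
  by apply: cent_joinEr; rewrite cents_cycle.
have xyzE : <[x]> <*> <[y]> <*> <[z]> = <[x]> <*> <[y]> * <[z]>.
  apply: cent_joinEr; rewrite cycle_subG; apply/centP => g.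
  rewrite /= xyE => /mulsgP[h k /cycleP[i ->] /cycleP[j ->] ->].
  apply: commuteM; apply: commuteX; exact: commute_sym.
have card_mul (A B : {group gT}) : (#|(A * B)%g| <= #|A| * #|B|)%N.
  by rewrite mul_cardG leq_pmulr // cardG_gt0.
apply: (@leq_trans #|<[x]> <*> <[y]> <*> <[z]>|).
  apply/subset_leq_card; rewrite gen_subG; apply/subsetP => g.
  rewrite !inE -orbA => /or3P[]/eqP->.
  - by rewrite mem_gen // inE mem_gen // inE cycle_id.
  - by rewrite mem_gen // inE mem_gen // inE cycle_id orbT.
  - by rewrite mem_gen // inE cycle_id orbT.
rewrite xyzE; apply: leq_trans (card_mul _ _) _.
rewrite -[8]/(4 * 2)%N leq_mul ?o2 //= xyE; apply: leq_trans (card_mul _ _) _.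
by rewrite -[4]/(2 * 2)%N leq_mul ?o2.
Qed.

Lemma right_group_parity_planar k (C : gT -> 'I_k -> Prop) (e : rel (gT * 'I_k)) :
    symmetric e ->
    (forall g i c j, C c j -> (g, i) != (g * c, j) -> e (g, i) (g * c, j)) ->
    (1 < k)%N -> <<[set g | `[< exists i, C g i >]]>> = [set: gT] ->
    parity_planar e ->
  cyclic [set: gT] \/ exists a b, <<[set a; b]>> = [set: gT] /\
    parity_planar (cayley_rel [set a; b; a * b]).
Proof.
move=> eC Ce k1 gC pe; set D := [set g | _] in gC.
(* A minimal set of first coordinates generating the group: no member lies in the subgroup generated
   by others. *)
pose P (A : {set gT}) := (A \subset D) && (<<A>> == [set: gT]).
have [E /minsetP [/andP[ED /eqP gE] Emin]] : {E | minset P E}.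
  by apply: ex_minset; exists D; rewrite /P subxx gC eqxx.
have contractT a i0 (T : {set gT}) : C a i0 -> (forall t, t \in T -> right_group_step C a i0 t) ->
    parity_planar (cayley_rel T).
  by move=> Ca TC; apply: (right_group_contract eC Ce k1 Ca TC pe).
have layer x : x \in E -> exists i, C x i.
  by move=> /(subsetP ED); rewrite inE => /asboolP.
have irr x (B : {set gT}) : x \in E -> B \subset E :\ x -> x \notin <<B>>.
  move=> xE BE; apply/negP => xB.
  have EE : E :\ x = E.
    apply: Emin (subD1set _ _); apply/andP; split.
      exact: subset_trans (subD1set _ _) ED.
    rewrite eqEsubset subsetT -gE gen_subG; apply/subsetP => y yE.
    case: (eqVneq y x) => [->|yx]; first by apply: subsetP xB; apply: genS.
    by rewrite mem_gen // !inE yx.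
  by move: xE; rewrite -EE !inE eqxx.
have irr1 x y : x \in E -> y \in E -> x != y -> x \notin <[y]>.
  by move=> xE yE xy; apply: irr => //; rewrite sub1set !inE eq_sym xy.
have irr2 x y z : x \in E -> y \in E -> z \in E -> x != y -> x != z ->
    x \notin <<[set y; z]>>.
  move=> xE yE zE xy xz; apply: irr => //.
  by apply/subsetP => g; rewrite !inE => /orP[]/eqP->; rewrite eq_sym ?xy ?xz.
have pair a i0 x : C a i0 -> x \in E -> exists u w,
    [/\ twist_pair a x u w, right_group_step C a i0 u & right_group_step C a i0 w].
  by move=> Ca /layer [i Cx]; apply: right_group_step_pair Ca Cx.
(* Any three members are commuting involutions in a group of order above 10. A fourth member gives
   six steps, and without one the order is at most 8. *)
have [E3|E2] := ltnP 2 #|E|.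
  have [x [y [z [[xE yE zE] [xy yz zx]]]]] := card_gt2P E3.
  have base a b c : a \in E -> b \in E -> c \in E -> a != b -> a != c -> b != c ->
     [/\ a ^+ 2 = 1, b ^+ 2 = 1, commute a b, c ^+ 2 = 1 & commute a c /\
       (10 < #|gT|)%N].
    move=> aE bE cE ab ac bc; have [i0 Ca] := layer a aE.
    have [u1 [w1 [p1 su1 sw1]]] := pair a i0 b Ca bE.
    have [u2 [w2 [p2 su2 sw2]]] := pair a i0 c Ca cE.
    apply: (twist_pairs_cayley p1 p2); try by apply: irr1; rewrite // eq_sym.
      by apply: irr2; rewrite // eq_sym.
    apply: (contractT a i0) => // t; rewrite inE /= !inE.
    by case/or4P => [/eqP->|/eqP->|/eqP->|/orP[]/eqP->] //; left; exists a => //; left.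
  have xz : x != z by rewrite eq_sym.
  have yx : y != x by rewrite eq_sym.
  have [x2 y2 cxy z2 [cxz g10]] := base x y z xE yE zE xy xz yz.
  have [_ _ cyz _ _] := base y z x yE zE xE yz yx zx.
  case: (set_0Vmem (E :\ x :\ y :\ z)) => [E0|[t]]; last first.
    rewrite !inE => /and4P[tz ty tx tE].
    have [i0 Cx] := layer x xE.
    have [u1 [w1 [p1 su1 sw1]]] := pair x i0 y Cx yE.
    have [u2 [w2 [p2 su2 sw2]]] := pair x i0 z Cx zE.
    have [u3 [w3 [p3 su3 sw3]]] := pair x i0 t Cx tE.
    have x1 : x != 1 by apply: contraNneq (irr1 x y xE yE xy) => ->; rewrite group1.
    exfalso; have zy : z != y by rewrite eq_sym.
    apply: (six_twists_cayley p1 p2 p3 x1 (irr1 _ _ yE xE yx) (irr1 _ _ zE xE zx)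
      (irr1 _ _ tE xE tx) (irr2 _ _ _ zE xE yE zx zy) (irr2 _ _ _ tE xE yE tx ty)
      (irr2 _ _ _ tE xE zE tx tz)).
    apply: (contractT x i0) => // g; rewrite inE /= !inE.
    by case/or4P => [/eqP->|/eqP->|/eqP->|/or3P[]/eqP->].
  exfalso; have := card_three_involutions x2 y2 z2 cxy cxz cyz.
  have -> : [set x; y; z] = E.
    apply/setP => g; rewrite !inE -orbA; apply/or3P/idP => [[]/eqP-> //|gE'].
    have : g \in E :\ x :\ y :\ z = false by rewrite E0 inE.
    rewrite !inE gE' andbT; case: eqVneq => [|_]; first by constructor 3.
    case: eqVneq => [|_]; first by constructor 2.
    by case: eqVneq => [_|_ //]; constructor 1.
  by rewrite gE cardsT leqNgt (leq_trans _ g10).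
case: (posnP #|E|) => [/eqP E0|E1].
  by left; rewrite -gE; move: E0; rewrite cards_eq0 => /eqP ->; rewrite gen0 cyclic1.
have [/eqP/cards1P [x Ex]|E1'] := eqVneq #|E| 1%N.
  by left; rewrite -gE Ex cycle_cyclic.
right; have /cards2P [a [b [ab Eab]]] : #|E| == 2%N.
  by move: E1 E2 E1'; case: #|E| => [|[|[|?]]].
have aE : a \in E by rewrite Eab !inE eqxx.
have bE : b \in E by rewrite Eab !inE eqxx orbT.
have [i0 Ca] := layer a aE; have [u [w [p su sw]]] := pair a i0 b Ca bE.
have pT := contractT a i0 [set a; u; w] Ca.
have {}pT : parity_planar (cayley_rel [set a; u; w]).
  apply: pT => t; rewrite !inE -orbA => /or3P[]/eqP-> //.
  by left; exists a => //; left.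
have gau : <<[set a; u]>> = [set: gT].
  apply/eqP; rewrite eqEsubset subsetT -gE gen_subG Eab; apply/subsetP => g.
  have aK : a \in <<[set a; u]>> by rewrite mem_gen // !inE eqxx.
  have [uK _] := twist_pair_mem p aK.
  by rewrite !inE => /orP[]/eqP->; rewrite // -uK mem_gen // !inE eqxx orbT.
(* Replacing [a] by its inverse if necessary puts [w] in the form [a * u]. *)
case: p => _ [wE|wE]; last by exists a, u; rewrite -wE.
exists a^-1, u; rewrite -wE; split.
  apply/eqP; rewrite eqEsubset subsetT -gau gen_subG; apply/subsetP => g.
  rewrite !inE => /orP[]/eqP->; last by rewrite mem_gen // !inE eqxx orbT.
  by rewrite -[a in a \in _]invgK groupV mem_gen // !inE eqxx.
apply: parity_planar_sub pT; apply: sub_cayley_rel => t.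
by rewrite !inE -orbA => /or3P[]/eqP->; rewrite ?invgK eqxx ?orbT.
Qed.
End RightGroups.

(** * Permutations of four and five points *)

(* Permutations are encoded by their lists of values so that statements about 'S_4
   and 'S_5 can be decided by computation. *)
Section PermCodes.
Variable n : nat.
Local Open Scope group_scope.
Implicit Types (p q : 'S_n) (s t : seq nat).

Definition perm_code p : seq nat := [seq (p i : nat) | i <- enum 'I_n].

Lemma nth_perm_code p (i : 'I_n) : nth 0 (perm_code p) i = p i.
Proof. by rewrite (nth_map i) ?size_enum_ord // nth_ord_enum. Qed.

Lemma size_perm_code p : size (perm_code p) = n.
Proof. by rewrite size_map size_enum_ord. Qed.

Lemma perm_code_inj : injective perm_code.
Proof. by move=> p q E; apply/permP => i; apply: val_inj; rewrite /= -!nth_perm_code E. Qed.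

Definition mulc s t := [seq nth 0 t i | i <- s].
Definition expc s m := iter m (fun t => mulc t s) (iota 0 n).
Definition swapc i j := [seq if k == i then j else if k == j then i else k | k <- iota 0 n].
Definition codes := permutations (iota 0 n).
(** The parity of the number of inversions. *)
Fixpoint oddc s := if s is x :: s' then odd (count (fun y => y < x) s') (+) oddc s' else false.

Lemma perm_codeM p q : perm_code (p * q) = mulc (perm_code p) (perm_code q).
Proof.
rewrite /mulc -map_comp; apply: eq_map => i /=.
by rewrite permM nth_perm_code.
Qed.

Lemma perm_code1 : perm_code 1 = iota 0 n.
Proof. by rewrite -val_enum_ord; apply: eq_map => i; rewrite perm1. Qed.

Lemma perm_codeX p m : perm_code (p ^+ m) = expc (perm_code p) m.
Proof. by elim: m => [|m IH]; rewrite ?expg0 ?perm_code1 // expgSr perm_codeM IH. Qed.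

Lemma perm_code_tperm (i j : 'I_n) : perm_code (tperm i j) = swapc i j.
Proof.
rewrite /swapc -val_enum_ord -map_comp; apply: eq_map => k /=.
case: tpermP => [->|->|/eqP ki /eqP kj]; rewrite ?eqxx //.
  by case: eqP.
by rewrite !(inj_eq val_inj) (negbTE ki) (negbTE kj).
Qed.

Lemma perm_code_mem p : perm_code p \in codes.
Proof.
rewrite mem_permutations -val_enum_ord; apply: uniq_perm.
- by rewrite map_inj_uniq ?enum_uniq // => i j /val_inj/perm_inj.
- by rewrite map_inj_uniq ?enum_uniq //; apply: val_inj.
- move=> m; apply/mapP/mapP => -[i _ ->]; first by exists (p i); rewrite ?mem_enum.
  by exists (p^-1 i); rewrite ?mem_enum ?permKV.
Qed.

Lemma perm_code_onto s : s \in codes -> exists p, perm_code p = s.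
Proof.
rewrite mem_permutations => sP; have sz : size s = n by rewrite (perm_size sP) size_iota.
have lt (i : 'I_n) : nth 0 s i < n.
  have : nth 0 s i \in s by rewrite mem_nth ?sz.
  by rewrite (perm_mem sP) mem_iota.
have inj : injective (fun i => Ordinal (lt i)).
  move=> i j [/eqP]; rewrite nth_uniq ?sz //; first by move/eqP/val_inj.
  by rewrite (perm_uniq sP) iota_uniq.
exists (perm inj); apply: (@eq_from_nth _ 0); rewrite size_perm_code ?sz // => i ni.
by rewrite -[i]/(nat_of_ord (Ordinal ni)) nth_perm_code permE.
Qed.

(** Inversion parity is the sign once it vanishes at the identity and flips under transpositions, a
    finite check. *)
Definition odd_check :=
  (oddc (iota 0 n) == false) &&
  all (fun i => all (fun j => (i == j) || all (fun s => oddc (mulc (swapc i j) s) == ~~ oddc s)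
    codes) (iota 0 n)) (iota 0 n).

Lemma odd_perm_code p : odd_check -> odd_perm p = oddc (perm_code p).
Proof.
case/andP => /eqP o1 /allP chk; have [ts -> dts] := prod_tpermP p.
elim: ts dts => [|[i j] ts IH] /=; first by rewrite big_nil odd_perm1 perm_code1 o1.
case/andP => ij /IH {}IH; rewrite big_cons odd_permM odd_tperm IH perm_codeM.
rewrite /= in ij; rewrite perm_code_tperm.
have iI (k : 'I_n) : (k : nat) \in iota 0 n by rewrite mem_iota add0n ltn_ord.
have /= /allP/(_ _ (iI j)) /= := chk _ (iI i).
rewrite (inj_eq val_inj) (negbTE ij) => /allP/(_ _ (perm_code_mem _)) /eqP ->.
by [].
Qed.
End PermCodes.

Lemma odd_check4 : odd_check 4. Proof. by vm_compute. Qed.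
Lemma odd_check5 : odd_check 5. Proof. by vm_compute. Qed.

(** For [s] other than the identity, some power [m] of [s] is trivial and some even [t] has [s ^ t]
    outside the cyclic group of [s], tested as [s * t] differing from all [t * s ^+ i]. Element
    orders in S_4 and S_5 are at most 6. *)
Definition normal_cycle_check n := all (fun s => (s == iota 0 n) ||
  has (fun m => (expc n s m == iota 0 n) && has (fun t => ~~ oddc t &&
    all (fun i => mulc s t != mulc t (expc n s i)) (iota 0 m)) (codes n)) (iota 1 6))
  (codes n).

Lemma normal_cycle_check4 : normal_cycle_check 4. Proof. by vm_compute. Qed.
Lemma normal_cycle_check5 : normal_cycle_check 5. Proof. by vm_compute. Qed.

Lemma perm_normal_cycle n (p : 'S_n) :
    odd_check n -> normal_cycle_check n -> p != 1%g ->
  exists2 q, q \in ('Alt_('I_n))%g & (p ^ q)%g \notin <[p]>%g.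
Proof.
move=> oc /allP/(_ _ (perm_code_mem p))/orP[/eqP p1|] np1.
  by case/eqP: np1; apply: perm_code_inj; rewrite p1 perm_code1.
case/hasP: np1 => m; rewrite mem_iota => /andP[m1 _] /andP[/eqP pm] /hasP[t tc].
case/andP => te /allP ti np1; have [q qt] := perm_code_onto tc.
exists q; first by rewrite Alt_even odd_perm_code // qt.
have pm1 : (p ^+ m = 1)%g by apply: perm_code_inj; rewrite perm_codeX pm perm_code1.
apply/negP => /cycleP [i pq].
have im : i %% m \in iota 0 m by rewrite mem_iota ltn_mod.
case/eqP: (ti _ im); rewrite -qt -perm_codeX -!perm_codeM; congr perm_code.
by rewrite expg_mod // -pq conjgE !mulgA mulgV mul1g.
Qed.

Lemma even_perm4 (p : 'S_4) : ~~ odd_perm p -> (p ^+ 2 = 1 \/ p ^+ 3 = 1)%g.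
Proof.
have chk : all (fun s => oddc s || (expc 4 s 2 == iota 0 4) || (expc 4 s 3 == iota 0 4))
  (codes 4) by vm_compute.
rewrite (odd_perm_code _ odd_check4) => pe.
have := allP chk _ (perm_code_mem p); rewrite (negbTE pe) -!perm_codeX -perm_code1.
by case/orP => /eqP/perm_code_inj; [left|right].
Qed.

Lemma even_perm5 (p : 'S_5) :
  ~~ odd_perm p -> (p ^+ 2 = 1 \/ (p ^+ 3 = 1 \/ p ^+ 5 = 1))%g.
Proof.
have chk : all (fun s => [|| oddc s, expc 5 s 2 == iota 0 5, expc 5 s 3 == iota 0 5 |
  expc 5 s 5 == iota 0 5]) (codes 5) by vm_compute.
rewrite (odd_perm_code _ odd_check5) => pe.
have := allP chk _ (perm_code_mem p); rewrite (negbTE pe) -!perm_codeX -perm_code1.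
by case/or4P => // /eqP/perm_code_inj; [left|right; left|right; right].
Qed.

Lemma perm4_exponent (p : 'S_4) : odd_perm p -> (p ^+ 4 = 1)%g.
Proof.
have chk : all (fun s => ~~ oddc s || (expc 4 s 4 == iota 0 4)) (codes 4) by vm_compute.
rewrite (odd_perm_code _ odd_check4) => po.
have := allP chk _ (perm_code_mem p); rewrite po -!perm_codeX -perm_code1.
by case/orP => // /eqP/perm_code_inj.
Qed.

(** The even permutations of square 1 form the Klein four-group. *)
Lemma even_involutions4_commute (p q : 'S_4) :
    ~~ odd_perm p -> ~~ odd_perm q -> (p ^+ 2 = 1 -> q ^+ 2 = 1 -> commute p q)%g.
Proof.
have chk : all (fun s => all (fun t => [|| oddc s, oddc t, expc 4 s 2 != iota 0 4,
  expc 4 t 2 != iota 0 4 | mulc s t == mulc t s]) (codes 4)) (codes 4) by vm_compute.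
rewrite !(odd_perm_code _ odd_check4) => pe qe p2 q2.
have := allP (allP chk _ (perm_code_mem p)) _ (perm_code_mem q).
rewrite (negbTE pe) (negbTE qe) -!perm_codeX p2 q2 perm_code1 eqxx /= -!perm_codeM.
by move=> /eqP/perm_code_inj.
Qed.

(** * Direct products with Z_2 *)

Section Z2Products.
Variable H : finGroupType.
Local Open Scope group_scope.
Notation G := ('Z_2 * H)%type.
Implicit Types (g h u v x y : G).

Lemma Z2_mulxx (z : 'Z_2) : z * z = 1.
Proof. by case: z => -[|[|]] //= lz; apply: val_inj. Qed.

Lemma Z2_nontrivial (z w : 'Z_2) : z != 1 -> w != 1 -> z = w.
Proof. by case: z w => -[|[|]] // lz [] [|[|]] // lw _ _; apply: val_inj. Qed.

Lemma Z2_expn (z : 'Z_2) n : z ^+ n = if odd n then z else 1.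
Proof. by elim: n => // n IH; rewrite expgS IH /=; case: odd; rewrite ?Z2_mulxx ?mulg1. Qed.

Lemma pair_expn (g : G) n : g ^+ n = (g.1 ^+ n, g.2 ^+ n).
Proof. by elim: n => // n IH; rewrite !expgS IH. Qed.

Lemma gen_ind_group (T : {set G}) (P : G -> bool) :
    P 1 -> (forall g h, P g -> P h -> P (g * h)) -> {in T, forall g, P g} ->
  <<T>> = [set: G] -> forall g, P g.
Proof.
move=> P1 PM PT gT g.
have gP : group_set [set h | P h].
  by apply/group_setP; split=> [|h k]; rewrite !inE //; apply: PM.
have : <<T>> \subset Group gP by rewrite gen_subG; apply/subsetP => h /PT; rewrite inE.
by rewrite gT => /subsetP/(_ g (in_setT g)); rewrite inE.
Qed.

(** A cyclic group has at most one subgroup of order 2; here the factor ['Z_2] gives one and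
    Cauchy's theorem in [H] another. *)
Lemma Z2_product_not_cyclic : 2 %| #|H| -> ~~ cyclic [set: G].
Proof.
move=> H2; apply/negP => cG.
have [t _ ot] : {t : H | t \in [set: H] & #[t] = 2%N}.
  by apply: Cauchy => //; rewrite cardsT.
have t1 : t != 1 by rewrite -order_gt1 ot.
have t2 : t ^+ 2 = 1 by rewrite -ot expg_order.
pose a : G := (inord 1, 1); pose b : G := (1, t).
have oa : #[a] = 2%N.
  apply: nt_prime_order => //; first by rewrite pair_expn Z2_expn expg1n.
  by apply/eqP => /(congr1 (fun g : G => val g.1)); rewrite /= inordK.
have ob : #[b] = 2%N.
  apply: nt_prime_order => //; by rewrite pair_expn Z2_expn /= t2.
have : <[a]> == <[b]> by rewrite (eq_subG_cyclic cG) ?subsetT // -!orderE oa ob.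
move=> /eqP ab; have := cycle_id a; rewrite ab => /cycleP [k].
rewrite pair_expn expg1n /= => -[/(congr1 val)].
by rewrite /= inordK.
Qed.

(* [v ^+ #[v.2]] is the central involution, and some [u] in [T] does not normalise
   [<[v ^+ 2]>], so [cayley_K33] applies. *)
Lemma cayley_central_twist (T : {set G}) v :
    (forall c : H, (forall h : H, c ^ h \in <[c]>) -> c = 1) ->
    <<T>> = [set: G] -> v \in T -> v.1 != 1 -> v.2 != 1 -> odd #[v.2] ->
  ~ parity_planar (cayley_rel T).
Proof.
move=> noc gT vT v1 v2 ov.
set p := #[v.2] in ov *.
have p2 : (2 < p)%N by move: ov; have := order_gt1 v.2; rewrite v2 -/p; case: (p) => [|[|[|]]].
have vp : v ^+ p = (v.1, 1) by rewrite pair_expn Z2_expn ov expg_order.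
have ord_v : #[v] = p.*2.
  apply/eqP; rewrite eqn_dvd order_dvdn; apply/andP; split.
    by rewrite pair_expn Z2_expn odd_double -mul2n expgM expgAC expg_order expg1n.
  have vv := expg_order v; move: vv; rewrite pair_expn => -[vv1 vv2].
  have d2 : 2 %| #[v].
    by rewrite dvdn2; apply/negP => od; move: vv1 v1; rewrite Z2_expn od => ->; rewrite eqxx.
  have dp : p %| #[v] by rewrite order_dvdn vv2.
  by rewrite -muln2 Gauss_dvd ?dp //= coprime_sym prime_coprime // dvdn2 ov.
have [/exists_inP [u uT vu]|/exists_inPn all_in] :=
    boolP [exists u in T, ((v ^+ 2) ^ u \notin <[v]>)].
  apply: (cayley_K33 uT vT p2 ord_v _ vu); rewrite vp /commute.
  by congr pair; rewrite /= ?mul1g ?mulg1 //; apply: GRing.addrC.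
(* Otherwise all generators normalise [<[v.2]>], which is then a normal cyclic subgroup of [H]. As
   [p] is odd, [v.2] is a power of its square. *)
have : forall g : G, v.2 ^ g.2 \in <[v.2]>.
  move=> g; suff: g.2 \in 'N(<[v.2]>) by move=> gN; rewrite memJ_norm // cycle_id.
  apply: (@gen_ind_group T (fun g => g.2 \in 'N(<[v.2]>))) gT g => //.
  - exact: group1.
  - by move=> g h; apply: groupM.
  move=> u uT; have := all_in u uT; rewrite negbK => /cycleP [k].
  move=> /(congr1 (fun g : G => g.2)); rewrite pair_expn => /= vk.
  have vE : v.2 = (v.2 ^+ 2) ^+ (p.+1)./2.
    by rewrite -expgM mul2n even_halfK /= ?ov // expgS expg_order mulg1.
  rewrite inE -cycleJ cycle_subG {1}vE conjXg groupX //.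
  by rewrite conjgE; move: vk; rewrite !pair_expn /= => ->; exact: mem_cycle.
by move=> N; case/eqP: v2; apply: noc => h; exact: (N (1, h)).
Qed.

(** Both [x] and [y] invert [x * y], so it generates a normal subgroup and is trivial; then [H] is
    generated by [x], and [x] is trivial too. *)
Lemma dihedral_normal_cycle (x y : H) :
    (forall c : H, (forall h : H, c ^ h \in <[c]>) -> c = 1) ->
    <<[set x; y]>> = [set: H] -> x ^+ 2 = 1 -> y ^+ 2 = 1 -> #|H| = 1%N.
Proof.
move=> noc gH x2 y2.
have V (z : H) : z ^+ 2 = 1 -> z^-1 = z.
  by move=> zz; apply/eqP; rewrite eq_invg_mul -{2}[z]expg1 -expgS zz.
have xV := V _ x2; have yV := V _ y2.
have normal c : x \in 'N(<[c]>) -> y \in 'N(<[c]>) -> c = 1.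
  move=> xN yN; apply: noc => h.
  have /subsetP/(_ h) : <<[set x; y]>> \subset 'N(<[c]>).
    by rewrite gen_subG; apply/subsetP => z /set2P[]->.
  by rewrite gH inE => /(_ isT) hN; rewrite memJ_norm // cycle_id.
have xy1 : x * y = 1.
  have cV : (x * y)^-1 = y * x by rewrite invMg xV yV.
  apply: normal; rewrite inE -cycleJ cycle_subG.
    have -> : (x * y) ^ x = (x * y)^-1 by rewrite conjgE -mulgA mulKg.
    by rewrite groupV cycle_id.
  have -> : (x * y) ^ y = (x * y)^-1.
    by rewrite conjgE -mulgA -{2}yV mulVg mulg1 yV.
  by rewrite groupV cycle_id.
have yx : y = x by apply: (mulgI x); rewrite xy1 -{1}xV mulVg.
have xT : <[x]> = [set: H] by rewrite -gH yx setUid.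
have x1 : x = 1 by apply: noc => h; rewrite xT inE.
by rewrite -cardsT -xT x1 cycle1 cards1.
Qed.
End Z2Products.

Lemma card_commuting_pair (gT : finGroupType) (x y : gT) :
  commute x y -> (#|<<[set x; y]>>%g| <= #[x]%g * #[y]%g)%N.
Proof.
move=> xy; have xyE : (<[x]> <*> <[y]> = <[x]> * <[y]>)%g.
  by apply: cent_joinEr; rewrite cents_cycle.
apply: (@leq_trans #|(<[x]> * <[y]>)%g|); last by rewrite mul_cardG leq_pmulr ?cardG_gt0.
rewrite -xyE; apply/subset_leq_card; rewrite gen_subG; apply/subsetP => g /set2P[]->.
  by rewrite mem_gen // inE cycle_id.
by rewrite mem_gen // inE cycle_id orbT.
Qed.

(** * Two-generator Cayley graphs of Z_2 x H for each family of H *)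

Section Cases.
Variable H : finGroupType.
Local Open Scope group_scope.
Notation G := ('Z_2 * H)%type.
Implicit Types (g u v x y a b : G).

Lemma gen_snd x y : <<[set x; y]>> = [set: G] -> <<[set x.2; y.2]>> = [set: H].
Proof.
move=> gG; apply/setP => h; rewrite inE.
apply: (@gen_ind_group _ _ (fun g => g.2 \in <<[set x.2; y.2]>>) _ _ _ gG (1, h)).
- exact: group1.
- by move=> g g'; apply: groupM.
- by move=> g /set2P[]->; rewrite mem_gen // !inE eqxx ?orbT.
Qed.

(** At least two of [a], [b], [a * b] have a nontrivial first coordinate, and any two of the three
    generate. *)
Lemma cayley_pair_central_twist a b :
    (forall c : H, (forall h : H, c ^ h \in <[c]>) -> c = 1) ->
    (forall x y, <<[set x; y]>> = [set: G] -> x.1 != 1 -> y.1 != 1 ->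
       (x.2 != 1) && odd #[x.2] || (y.2 != 1) && odd #[y.2]) ->
    <<[set a; b]>> = [set: G] ->
  ~ parity_planar (cayley_rel [set a; b; a * b]).
Proof.
move=> noc dich gab.
have gT : <<[set a; b; a * b]>> = [set: G].
  by apply/eqP; rewrite eqEsubset subsetT -gab genS // subsetUl.
have use x y : x \in [set a; b; a * b] -> y \in [set a; b; a * b] ->
    <<[set x; y]>> = [set: G] -> x.1 != 1 -> y.1 != 1 ->
    ~ parity_planar (cayley_rel [set a; b; a * b]).
  move=> xT yT gxy x1 y1; case/orP: (dich _ _ gxy x1 y1) => /andP[z1 oz].
    exact: (cayley_central_twist noc gT xT x1 z1 oz).
  exact: (cayley_central_twist noc gT yT y1 z1 oz).
have gen x y : a \in <<[set x; y]>> -> b \in <<[set x; y]>> ->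
    <<[set x; y]>> = [set: G].
  move=> aK bK; apply/eqP; rewrite eqEsubset subsetT -gab gen_subG.
  by apply/subsetP => g /set2P[]->.
have inl x y : x \in <<[set x; y]>> by rewrite mem_gen // set21.
have inr x y : y \in <<[set x; y]>> by rewrite mem_gen // set22.
have aT : a \in [set a; b; a * b] by rewrite !inE eqxx.
have bT : b \in [set a; b; a * b] by rewrite !inE eqxx orbT.
have abT : a * b \in [set a; b; a * b] by rewrite !inE eqxx orbT.
have [a1|a1] := eqVneq a.1 1; have [b1|b1] := eqVneq b.1 1.
- have /eqP : (inord 1 : 'Z_2, 1 : H).1 == 1.
    apply: (@gen_ind_group _ _ (fun g => g.1 == 1) _ _ _ gab) => //.
    - by move=> g h /eqP g1 /eqP h1; rewrite /= g1 h1 mulg1.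
    - by move=> g /set2P[]->; rewrite ?a1 ?b1.
  by move/(congr1 val); rewrite /= inordK.
- apply: (use b (a * b)) => //; last by rewrite /= a1 mul1g.
  apply: gen => //; rewrite -(groupMr _ (inl b (a * b))).
  exact: inr.
- apply: (use a (a * b)) => //; last by rewrite /= b1 mulg1.
  apply: gen => //; rewrite -(groupMl _ (inl a (a * b))).
  exact: inr.
- exact: (use a b).
Qed.

Section Permutations.
Variables (n : nat) (A : {group 'S_n}) (f : {morphism [set: H] >-> {perm 'I_n}}).
Hypotheses (fI : 'injm f) (fA : f @* [set: H] = A) (AltA : 'Alt_('I_n) \subset A).

Lemma injm_eq1 (x : H) : f x = 1 -> x = 1.
Proof. by move=> fx; apply: (injmP fI); rewrite ?inE // morph1. Qed.

Lemma injm_expn_eq1 (x : H) m : f x ^+ m = 1 -> x ^+ m = 1.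
Proof. by move=> fx; apply: injm_eq1; rewrite morphX ?inE. Qed.

(** The conjugator found for [f c] is even, so it lies in the image [A]. *)
Lemma no_normal_cycle (c : H) :
  odd_check n -> normal_cycle_check n -> (forall h : H, c ^ h \in <[c]>) -> c = 1.
Proof.
move=> oc nc cN; apply/eqP; apply: contraT => c1.
have fc1 : f c != 1 by apply: contraNneq c1 => /injm_eq1 ->.
have [q qA] := perm_normal_cycle oc nc fc1.
have : q \in f @* [set: H] by rewrite fA; apply: subsetP qA.
case/morphimP => h _ _ ->; rewrite -morphJ ?inE // -morphim_cycle ?inE //.
by rewrite mem_morphim ?inE ?cN.
Qed.
End Permutations.

Lemma odd_order_expn (x : H) m : odd m -> x ^+ m = 1 -> odd #[x].
Proof. by move=> om /eqP; rewrite -order_dvdn => /dvdn_odd; apply. Qed.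

(** Every element of [H] has square 1 or odd order. If neither second coordinate is nontrivial of
    odd order, [H] is generated by two elements of square 1. *)
Lemma Alt_dichotomy n (f : {morphism [set: H] >-> {perm 'I_n}}) :
    'injm f -> f @* [set: H] = 'Alt_('I_n) -> (1 < #|H|)%N ->
    odd_check n -> normal_cycle_check n ->
    (forall p : 'S_n, ~~ odd_perm p -> p ^+ 2 = 1 \/ exists2 m, odd m & p ^+ m = 1) ->
  forall x y, <<[set x; y]>> = [set: G] ->
    (x.2 != 1) && odd #[x.2] || (y.2 != 1) && odd #[y.2].
Proof.
move=> fI fA H1 oc nc exps x y gxy.
have noc c := no_normal_cycle fI fA (subxx _) oc nc (c := c).
have ev (z : H) : ~~ odd_perm (f z).
  by rewrite -Alt_even -fA mem_morphim ?inE.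
have dich (z : H) : ((z != 1) && odd #[z]) || (z ^+ 2 == 1).
  have [z2|[m om zm]] := exps _ (ev z); first by rewrite (injm_expn_eq1 fI z2) eqxx orbT.
  rewrite (odd_order_expn om (injm_expn_eq1 fI zm)) andbT.
  by case: eqVneq => //= ->; rewrite expg1n.
have := dich x.2; have := dich y.2.
case: (_ && _) => //=; first by rewrite orbT.
case: (_ && _) => //= /eqP y2 /eqP x2.
by have := dihedral_normal_cycle noc (gen_snd gxy) x2 y2; move: H1 => /[swap] ->.
Qed.

Lemma Sym4_dichotomy (f : {morphism [set: H] >-> {perm 'I_4}}) :
    'injm f -> f @* [set: H] = 'Sym_('I_4) -> (1 < #|H|)%N ->
  forall x y, <<[set x; y]>> = [set: G] -> x.1 != 1 -> y.1 != 1 ->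
    (x.2 != 1) && odd #[x.2] || (y.2 != 1) && odd #[y.2].
Proof.
move=> fI fA H1 x y gxy x1 y1.
have noc c := no_normal_cycle fI fA (subsetT _) odd_check4 normal_cycle_check4 (c := c).
have sM (h h' : H) : odd_perm (f (h * h')) = odd_perm (f h) (+) odd_perm (f h').
  by rewrite morphM ?inE // odd_permM.
have s1 : odd_perm (f 1) = false by rewrite morph1 odd_perm1.
(* If both were odd, the first coordinate would equal the sign on all of [G], which fails at (1,
   identity); if both were even, [H] would have no odd element. *)
have sgn : odd_perm (f x.2) != odd_perm (f y.2).
  apply/negP => /eqP sxy; case: (boolP (odd_perm (f x.2))) => sx.
    have nM (z w : 'Z_2) : (z * w != 1) = (z != 1) (+) (w != 1).
      have [->|z1] := eqVneq z 1; first by rewrite mul1g.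
      have [->|w1] := eqVneq w 1; first by rewrite mulg1 z1.
      by rewrite (Z2_nontrivial z1 w1) Z2_mulxx eqxx.
    have : ((inord 1 : 'Z_2) != 1) == odd_perm (f 1).
      apply: (@gen_ind_group _ _ (fun g => (g.1 != 1) == odd_perm (f g.2)) _ _ _ gxy
        (inord 1, 1)).
      - by rewrite /= s1.
      - by move=> g h /eqP gP /eqP hP; rewrite /= sM nM gP hP.
      - by move=> g /set2P[]->; rewrite ?x1 ?y1 -?sxy sx.
    by rewrite s1 -(inj_eq val_inj) /= inordK.
  have all_even (h : H) : ~~ odd_perm (f h).
    apply: (@gen_ind_group _ _ (fun g => ~~ odd_perm (f g.2)) _ _ _ gxy (1, h)).
    - by rewrite /= s1.
    - by move=> g h' /negbTE gP /negbTE hP; rewrite /= sM gP hP.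
    - by move=> g /set2P[]->; rewrite -?sxy.
  have : tperm (ord0 : 'I_4) ord_max \in f @* [set: H] by rewrite fA inE.
  by case/morphimP => h _ _ E; have := all_even h; rewrite -E odd_tperm.
wlog sx : x y gxy x1 y1 sgn / ~~ odd_perm (f x.2).
  move=> W; case: (boolP (odd_perm (f x.2))) => sx; last exact: W.
  rewrite orbC; apply: W => //; first by rewrite setUC.
    by rewrite eq_sym.
  by move: sgn; rewrite sx; case: odd_perm.
have sy : odd_perm (f y.2) by move: sgn; rewrite (negbTE sx); case: odd_perm.
case: (boolP ((x.2 != 1) && odd #[x.2])) => //= nx.
have x2 : x.2 ^+ 2 = 1.
  case: (even_perm4 sx) => xm; first exact: injm_expn_eq1 xm.
  move: nx; rewrite (odd_order_expn _ (injm_expn_eq1 fI xm)) // andbT negbK => /eqP ->.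
  exact: expg1n.
have gH := gen_snd gxy.
(* [y.2 ^+ 2] and [x.2] correspond to elements of the Klein four-group, so they commute; thus
   [y.2 ^+ 2] is central, hence trivial. *)
have y2 : y.2 ^+ 2 = 1.
  apply: noc => h.
  have xc : commute (x.2) (y.2 ^+ 2).
    apply: (injmP fI); rewrite ?inE // [f (x.2 * _)]morphM ?inE // [f (_ * x.2)]morphM ?inE //.
    have yy : ~~ odd_perm (f (y.2 ^+ 2)) by rewrite expgS expg1 sM addbb.
    apply: (even_involutions4_commute sx yy); rewrite -morphX ?inE //.
      by rewrite x2 morph1.
    by rewrite -expgM morphX ?inE // perm4_exponent.
  have yc : commute (y.2) (y.2 ^+ 2) by apply: commuteX.
  have : <<[set x.2; y.2]>> \subset 'C[y.2 ^+ 2].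
    by rewrite gen_subG; apply/subsetP => g /set2P[]->; apply/cent1P; apply: commute_sym.
  rewrite gH => /subsetP/(_ h (in_setT h))/cent1P hc.
  by rewrite conjgE -hc mulKg cycle_id.
by have := dihedral_normal_cycle noc gH x2 y2; move: H1 => /[swap] ->.
Qed.

(** [G] is abelian but not cyclic. If one of [a], [b], [a * b] has square 1, it serves as [t] in
    [cayley_K5]; otherwise the three and their inverses are six distinct steps. *)
Lemma cayley_cyclic_factor a b :
    cyclic [set: H] -> (2 < #|H|)%N -> ~~ cyclic [set: G] ->
    <<[set a; b]>> = [set: G] ->
  ~ parity_planar (cayley_rel [set a; b; a * b]).
Proof.
move=> cH H2 ncG gab pp.
have com g h : commute g h.
  have /centsP HC := cyclic_abelian cH.
  by rewrite /commute; congr pair; [apply: GRing.addrC|apply: HC; rewrite inE].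
have noc t c : <<[set t; c]>> = [set: G] -> t \notin <[c]>.
  move=> gtc; apply: contraNN ncG => tc; rewrite -gtc.
  have -> : <<[set t; c]>> = <[c]>.
    apply/eqP; rewrite eqEsubset gen_subG genS ?sub1set ?set22 // andbT.
    by apply/subsetP => g /set2P[]->; rewrite ?cycle_id.
  exact: cycle_cyclic.
have gen x y : a \in <<[set x; y]>> -> b \in <<[set x; y]>> ->
    <<[set x; y]>> = [set: G].
  move=> aK bK; apply/eqP; rewrite eqEsubset subsetT -gab gen_subG.
  by apply/subsetP => g /set2P[]->.
have gba : <<[set b; a]>> = [set: G] by rewrite setUC.
have inl x y : x \in <<[set x; y]>> by rewrite mem_gen // set21.
have inr x y : y \in <<[set x; y]>> by rewrite mem_gen // set22.
have K5 t c : <<[set t; c]>> = [set: G] -> t ^+ 2 = 1 ->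
    ~ parity_planar (cayley_rel [set t; c; t * c]).
  move=> gtc t2; apply: (@cayley_K5 _ _ t c); rewrite ?inE ?eqxx ?orbT ?noc //.
  (* Here |G| = 2|H| > 4 is at most [#[t] * #[c]], and [#[t]] is at most 2, so [#[c]] exceeds 2. *)
  have := card_commuting_pair (com t c); rewrite gtc cardsT card_prod card_ord /= => le.
  have : (#[t] <= 2)%N by rewrite dvdn_leq // order_dvdn t2.
  by move: le H2; move: #[t] #[c] #|H| => i j k; clear; nia.
have [a2|a2] := eqVneq (a ^+ 2) 1; first exact: (K5 a b).
have [b2|b2] := eqVneq (b ^+ 2) 1.
  by apply: (K5 b a) => //; rewrite com [[set b; a]]setUC.
have [ab2|ab2] := eqVneq ((a * b) ^+ 2) 1.
  apply: (K5 (a * b) b^-1) => //.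
    have bK : b \in <<[set a * b; b^-1]>> by rewrite -groupV inr.
    by apply: gen => //; rewrite -(groupMr _ bK) inl.
  rewrite mulgK; apply: parity_planar_sub pp; apply: sub_cayley_rel => t.
  by rewrite !inE -orbA => /or3P[]/eqP->; rewrite ?invgK eqxx ?orbT.
have aB := noc _ _ gab; have bA := noc _ _ gba.
have abA : a * b \notin <[a]> by rewrite groupMl ?cycle_id.
have abB : a * b \notin <[b]> by rewrite groupMr ?cycle_id.
have neP (K : {group G}) g h : g \in K -> h \notin K -> (g == h) = false.
  by move=> gK; apply: contraNF => /eqP <-.
have neV g : g ^+ 2 != 1 -> g != g^-1.
  by apply: contraNneq => E; rewrite expgS expg1 {1}E mulVg.
have aA : a \in <[a]> by apply: cycle_id.
have bB : b \in <[b]> by apply: cycle_id.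
apply: (@cayley_six _ _ [:: a; a^-1; b; b^-1; a * b; (a * b)^-1]) pp => //.
- rewrite !inE !negb_or -!andbA; apply/and3P; split.
  + by rewrite (neP <[b]>%G).
  + by rewrite (neP <[a]>%G).
  + by rewrite (neP <[a]>%G).
- rewrite /= !inE !negb_or !neV // !andbT !(neP <[a]>%G a) ?groupV //.
  rewrite !(neP <[a]>%G a^-1) ?groupV //.
  by rewrite !(neP <[b]>%G b) ?groupV // !(neP <[b]>%G b^-1) ?groupV.
move=> g; rewrite in_setU mem_invg !inE => /or4P[/eqP->|/eqP->|/eqP->|/or3P[]/eqP->];
  by rewrite ?invgK eqxx ?orbT.
Qed.

(** The rotation order 2n is even, so [H] maps onto Z_2 x Z_2 and [G] onto Z_2^3, where two elements
    generate at most four. *)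
Lemma dihedral_factor_generators n a b :
    (0 < n)%N -> [set: H] \isog [set: dihedral_gtype (2 * (2 * n))] ->
  <<[set a; b]>> <> [set: G].
Proof.
move=> n0 isoH gab.
have q1 : (1 < 2 * n)%N by lia.
pose K := ('Z_2 * 'Z_2)%type; pose x : K := (inord 1, 1); pose y : K := (1, inord 1).
have sq (k : K) : k ^+ 2 = 1 by rewrite pair_expn !Z2_expn.
have gK : [set: K] = <[x]> <*> <[y]>.
  apply/eqP; rewrite eqEsubset subsetT andbT; apply/subsetP => -[z w] _.
  have xK : x \in <[x]> <*> <[y]> by rewrite mem_gen // inE cycle_id.
  have yK : y \in <[x]> <*> <[y]> by rewrite mem_gen // inE cycle_id orbT.
  have Z (v : 'Z_2) : v != 1 -> v = inord 1.
    by move/Z2_nontrivial; apply; rewrite -(inj_eq val_inj) /= inordK.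
  have -> : (z, w) = (if z == 1 then 1 else x) * (if w == 1 then 1 else y) :> K.
    by case: eqVneq => [->|/Z ->]; case: eqVneq => [->|/Z ->]; congr pair;
      rewrite /= ?mulg1 ?mul1g.
  by apply: groupM; case: ifP.
have homK : [set: K] \homg [set: H].
  apply: homg_trans (isog_hom (_ : [set: dihedral_gtype (2 * (2 * n))] \isog _)); last first.
    by rewrite isog_sym.
  rewrite [(2 * (2 * n))%N]mul2n Grp_dihedral //; apply/existsP; exists (x, y).
  have xn : x ^+ (2 * n) = 1 by rewrite expgM sq expg1n.
  have xy : x ^ y = x^-1.
    have -> : x ^ y = x.
      by rewrite conjgE (_ : x * y = y * x) ?mulKg //; congr pair; apply: GRing.addrC.
    by apply/esym/eqP; rewrite eq_invg_mul -{2}[x]expg1 -expgS sq.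
  by rewrite /= -gK xn xy sq eqxx.
have /homgP [f fT] := homK.
pose F (g : G) : 'Z_2 * K := (g.1, f g.2).
have sq' (k : ('Z_2 * K)%type) : k ^+ 2 = 1 by rewrite pair_expn Z2_expn sq.
have gF : <<[set F a; F b]>> = [set: ('Z_2 * K)%type].
  apply/setP => -[z k]; rewrite inE.
  have : k \in f @* [set: H] by rewrite fT inE.
  case/morphimP => h _ _ ->.
  apply: (@gen_ind_group _ _ (fun g => F g \in <<[set F a; F b]>>) _ _ _ gab (z, h)).
  - by rewrite /F /= morph1 group1.
  - move=> g g' Fg Fg'; rewrite /F /= morphM ?inE //; exact: (groupM Fg Fg').
  - by move=> g /set2P[]->; rewrite mem_gen // ?set21 ?set22.
have com : commute (F a) (F b).
  by rewrite /commute; congr (_, (_, _)); apply: GRing.addrC.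
have := card_commuting_pair com; rewrite gF cardsT !card_prod !card_ord /= leqNgt.
have o2 k : (#[k : ('Z_2 * K)%type] <= 2)%N by rewrite dvdn_leq // order_dvdn sq'.
have := leq_mul (o2 (F a)) (o2 (F b)).
by move: #[_] #[_] => i j; clear; lia.
Qed.
End Cases.

(** * From the right group to its group factor, and conclusion *)

Lemma generates_right_group (gT : finGroupType) (k : nat)
    (C : set (gT * right_zero_band k)%type) :
    (0 < k)%N -> generates C ->
  <<[set g | `[< exists i, C (g, i) >]]>>%g = [set: gT].
Proof.
move=> k0 gC; apply/setP => g; rewrite inE.
(* The elements with first coordinate in [D] form a subsemigroup containing [C]. *)
set D := <<_>>%g; pose A := [set s : (gT * right_zero_band k)%type | s.1 \in D]%classic.
suff : A (g, Ordinal k0) by [].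
have : [set: (gT * right_zero_band k)%type]%classic (g, Ordinal k0) by [].
rewrite -gC; apply: smallest_sub.
  by move=> x y xD yD; rewrite /A /=; apply: groupM.
move=> -[h i] Chi; rewrite /A /= mem_gen // inE; apply/asboolP.
by exists i.
Qed.

Theorem theorem6p5 (R : realType) (n k : nat) (H : finGroupType) :
  (1 <= n)%N -> (2 <= k)%N ->
  ([set: H] \isog [set: 'Z_(2 * (n + 1))])%g \/
  ([set: H] \isog [set: dihedral_group (2 * n)])%g \/
  ([set: H] \isog ('Alt_('I_4))%g)%g \/
  ([set: H] \isog ('Sym_('I_4))%g)%g \/
  ([set: H] \isog ('Alt_('I_5))%g)%g ->
  ~ planar_semigroup R ('Z_2 * H * right_zero_band k)%type.
Proof.
move=> n1 k2 HH [C [gC /planar_graph_parity pl]].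
have Z2n : (1 < 2 * (n + 1))%N by lia.
(* Even order makes [G] non-cyclic; order above 2 serves the cyclic family and excludes trivial
   [H]. *)
have card_even : (2 %| #|H|)%N && (2 < #|H|)%N.
  rewrite -cardsT; case: HH => [|[|[|[|]]]] /card_isog ->.
  - by rewrite cardsT card_ord Zp_cast // dvdn_mulr //; lia.
  - by rewrite /dihedral_group mul2n card_dihedral -?muln2 ?dvdn_mull //; lia.
  - by have := @card_Alt 'I_4; rewrite card_ord => /(_ isT) E;
      rewrite -(mulKn #|_| (isT : 0 < 2)%N) E.
  - by rewrite card_Sym card_ord.
  - by have := @card_Alt 'I_5; rewrite card_ord => /(_ isT) E;
      rewrite -(mulKn #|_| (isT : 0 < 2)%N) E.
have [H2 H3] := andP card_even.
have adj_sym : symmetric [rel u v | `[< cayley_adj C u v >]].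
  have sym s t : cayley_adj C s t -> cayley_adj C t s.
    by case=> st h; split; [exact: nesym|case: h; [right|left]].
  by move=> u v /=; apply/asboolP/asboolP => /sym.
have adj_arc g i c j : C (c, j) -> (g, i) != ((g * c)%g, j) ->
    `[< cayley_adj C (g, i) ((g * c)%g, j) >].
  by move=> Cc /eqP ne; apply/asboolP; split=> //; left; exists (c, j).
have gD := generates_right_group (ltnW k2) gC.
have [cG|[a [b [gab]]]] := right_group_parity_planar adj_sym adj_arc k2 gD pl.
  by have := Z2_product_not_cyclic H2; rewrite cG.
case: HH => [isoH|[isoH|[isoH|[isoH|isoH]]]].
- have cH : cyclic [set: H].
    by rewrite (isog_cyclic isoH); apply/cyclicP; exists Zp1; rewrite -Zp_cycle.
  exact: (cayley_cyclic_factor cH H3 (Z2_product_not_cyclic H2) gab).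
- by have := dihedral_factor_generators n1 isoH gab.
- have /isogP [f fI fA] := isoH.
  have noc c := no_normal_cycle fI fA (subxx _) odd_check4 normal_cycle_check4 (c := c).
  apply: (cayley_pair_central_twist noc _ gab) => x y gxy _ _.
  apply: (Alt_dichotomy fI fA _ odd_check4 normal_cycle_check4 _ gxy); first exact: ltnW.
  by move=> p /even_perm4[]; [left|right; exists 3].
- have /isogP [f fI fA] := isoH.
  have noc c := no_normal_cycle fI fA (subsetT _) odd_check4 normal_cycle_check4 (c := c).
  apply: (cayley_pair_central_twist noc _ gab) => x y.
  by apply: (Sym4_dichotomy fI fA); exact: ltnW.
have /isogP [f fI fA] := isoH.
have noc c := no_normal_cycle fI fA (subxx _) odd_check5 normal_cycle_check5 (c := c).
apply: (cayley_pair_central_twist noc _ gab) => x y gxy _ _.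
apply: (Alt_dichotomy fI fA _ odd_check5 normal_cycle_check5 _ gxy); first exact: ltnW.
by move=> p /even_perm5[|[]]; [left|right; exists 3|right; exists 5].
Qed.
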